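(* Let $M$ be a complete metric space. Then the following are equivalent. (a) $M$ is purely 1-unrectifiable. (b) $\mathrm{SMA}(N)$ is dense in $\mathrm{Lip}_0(N)$ for every bi-Lipschitz copy $N$ of a closed subset of $M$. (c) $\mathrm{SMA}(N,Y)$ is dense in $\mathrm{Lip}_0(N,Y)$ for every bi-Lipschitz copy $N$ of a closed subset of $M$ and for every (real) Banach space $Y$.
   Context: A metric space $M$ is purely 1-unrectifiable if every Lipschitz image in $M$ of a subset of $\mathbb{R}$ has zero 1-dimensional Hausdorff measure, i.e. $\mathcal{H}^1(\gamma(A))=0$ for every $A\subseteq\mathbb{R}$ and every Lipschitz map $\gamma:A\to M$. A metric space $N$ is a bi-Lipschitz copy of a metric space $K$ if there are a bijection $\phi:K\to N$ and constants $C>c>0$ with $c\,d_K(p,q)\le d_N(\phi(p),\phi(q))\le C\,d_K(p,q)$ for all $p,q\in K$. Metric spaces $N$ are regarded as pointed, with a distinguished point denoted $0\in N$. For a pointed metric space $(N,d)$ and a real Banach space $Y$, $\mathrm{Lip}_0(N,Y)$ is the Banach space of all Lipschitz maps $f:N\to Y$ with $f(0)=0$, with the Lipschitz norm $\|f\|=\sup_{p\neq q\in N}\frac{\|f(p)-f(q)\|}{d(p,q)}$. Density is with respect to this norm. For $f\in\mathrm{Lip}_0(N,Y)$, the minimum modulus is $m(f)=\inf_{p\neq q\in N}\frac{\|f(p)-f(q)\|}{d(p,q)}$, and $f$ strongly attains its minimum if there are $p\neq q\in N$ with $\frac{\|f(p)-f(q)\|}{d(p,q)}=m(f)$. $\mathrm{SMA}(N,Y)$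 is the set of all $f\in\mathrm{Lip}_0(N,Y)$ that strongly attain their minimum. When $Y=\mathbb{R}$ one writes $\mathrm{Lip}_0(N)$ and $\mathrm{SMA}(N)$. *)

(* Defs.v *)
From HB Require Import structures.
From mathcomp Require Import all_boot all_order all_algebra.
From mathcomp Require Import all_classical all_reals all_analysis.

Set Implicit Arguments.
Unset Strict Implicit.
Unset Printing Implicit Defensive.

Import Order.TTheory GRing.Theory Num.Theory.
Import numFieldNormedType.Exports.

Local Open Scope classical_set_scope.
Local Open Scope ring_scope.

(* The library's [Complete] structure is restricted to pointed types; this is
   the same condition, but it also covers the empty metric space. *)
Definition complete_metric (R : realType) (M : metricType R) : Prop :=
  forall F : set_system M, ProperFilter F -> cauchy F -> exists l : M, F --> l.

Section Hausdorff_measure.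
Context {R : realType} {M : metricType R}.
Implicit Types A E : set M.
Local Open Scope ereal_scope.

(* The point 0 is adjoined because the supremum of the empty set in [\bar R]
   is -oo, whereas the diameter of the empty set is 0. *)
Definition diam A : \bar R :=
  ereal_sup (0 |` [set (mdist x y)%:E | x in A & y in A]).

Definition hausdorff1_delta (delta : R) E : \bar R :=
  ereal_inf [set \sum_(0 <= i <oo) diam (U i) |
    U in [set U : (set M)^nat |
      (forall i, diam (U i) <= delta%:E) /\ E `<=` \bigcup_i U i]].

Definition hausdorff1 E : \bar R :=
  ereal_sup [set hausdorff1_delta delta E | delta in [set d : R | (0 < d)%R]].

End Hausdorff_measure.

(* A map defined on A is represented by the restriction to A of a total one. *)
Definition purely_1_unrectifiable (R : realType) (M : metricType R) : Prop :=
  forall (A : set R) (gamma : R -> M),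
    (exists L : R, forall s t : R, A s -> A t ->
       mdist (gamma s) (gamma t) <= L * `|s - t|) ->
    hausdorff1 (gamma @` A) = 0%E.

(* N is a bi-Lipschitz copy of the subspace K of M; only the values of phi on K
   matter. *)
Definition bilipschitz_copy (R : realType) (M N : metricType R) (K : set M) :
    Prop :=
  exists (phi : M -> N) (c C : R),
    [/\ set_bij K [set: N] phi, 0 < c, c < C &
      forall p q : M, K p -> K q ->
        c * mdist p q <= mdist (phi p) (phi q) <= C * mdist p q].

(* On a one-point space no map strongly attains its minimum, as there is no pair
   of distinct points, so SMA is empty while Lip0 is {0}. *)
Definition has_two_points (T : Type) : Prop := exists p q : T, p <> q.

Section Lipschitz_maps.
Context {R : realType} {N : metricType R} {Y : completeNormedModType R}.
Implicit Types (z : N) (f g : N -> Y).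

Definition slope f (p q : N) : R := `|f p - f q| / mdist p q.

Definition slopes f : set R :=
  [set r | exists p q : N, p <> q /\ r = slope f p q].

(* z is the distinguished point of N. *)
Definition Lip0 z : set (N -> Y) :=
  [set f | f z = 0 /\
    exists L : R, forall p q : N, `|f p - f q| <= L * mdist p q].

Definition lip_norm f : R := sup (slopes f).

Definition min_modulus f : R := inf (slopes f).

Definition strongly_attains_min f : Prop :=
  exists p q : N, p <> q /\ slope f p q = min_modulus f.

Definition SMA z : set (N -> Y) :=
  [set f | Lip0 z f /\ strongly_attains_min f].

Definition SMA_dense z : Prop :=
  forall f, Lip0 z f -> forall e : R, 0 < e ->
    exists g, SMA z g /\ lip_norm (f - g) < e.

End Lipschitz_maps.
Arguments Lip0 {R N} Y z.
Arguments SMA {R N} Y z.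
Arguments SMA_dense {R N} Y z.

(* Main.v *)
(* (a) -> (c). Let f have minimum modulus m > 0 (if m = 0, a small perturbation
   of f collapses a pair to slope 0). A step from x to y costs d(x, y), but if
   (x, y) is not close to a fixed pair (p, q) and the excess of |f x - f y| over
   m d(x, y) is small, it costs slightly less; let h x be the infimum of the costs
   of walks from p to x. If h q is not too small, subtracting a small multiple
   of h from f in the direction f q - f p yields a map whose slopes are smaller
   near (p, q) than anywhere else. If this fails for every pair of small excess,
   every such pair is joined by cheap walks whose discounted steps are again
   pairs of this kind, at a smaller scale; iterating, the nested walks converge
   to a 2-Lipschitz curve fragment, and the distances to p of its points fill a
   set of positive measure, against pure 1-unrectifiability. Iterating the
   perturbation with closer and closer pairs gives a limit map that attains its
   minimum at the limit pair.

   (b) -> (a). If gamma is Lipschitz on A and its image is not null, then some a,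
   b in A have d(gamma a, gamma b) larger than a multiple of the measure of
   [a, b] minus A; the rising sun lemma applied to t |-> d(gamma a, gamma t) - c t
   gives a compact E of positive measure on which gamma is bi-Lipschitz, so that
   E is a bi-Lipschitz copy of a compact subset of M. Take B in E such that B and
   E minus B have positive measure in the same intervals, and let
   f t = 2 t - |B n ]-oo, t]|. A map near f that attains its minimum at (p, q) is
   affine on E n [p, q] with slope close to 1, whereas f has slopes close to 2
   at the density points of E minus B. *)
Require Import Defs.
From HB Require Import structures.
From mathcomp Require Import all_boot all_order all_algebra.
From mathcomp Require Import all_classical all_reals all_analysis.
From mathcomp Require Import measurable_realfun ring lra.
Import Order.TTheory GRing.Theory Num.Theory.
Import numFieldNormedType.Exports.
Local Open Scope classical_set_scope.
Local Open Scope ring_scope.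

Set Implicit Arguments.
Unset Strict Implicit.
Unset Printing Implicit Defensive.

(** * Walks *)

(** Steps form a relation rather than a cost function, because a [refining_step] between two given
    points may carry either of two costs. *)
Inductive walk (R : realType) (N : Type) (S : N -> N -> R -> Prop) :
    N -> N -> R -> Prop :=
| walk_nil x : walk S x x 0
| walk_cons x y z s l : S x y s -> walk S y z l -> walk S x z (s + l).

Definition cost_step (R : realType) (N : Type) (c : N -> N -> R) (x y : N) :
  R -> Prop := fun s => s = c x y.

(** For [c >= 0] this is, as a function of [x], the largest one that vanishes at [p] and grows by at
    most [c] along each step. *)
Definition walk_dist (R : realType) (N : Type) (c : N -> N -> R) (p x : N) : R :=
  inf [set l | walk (cost_step c) p x l].

Lemma walk_ge (R : realType) (N : metricType R) (S : N -> N -> R -> Prop)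
    (k : R) x z l : (forall x y s, S x y s -> k * mdist x y <= s) -> 0 <= k ->
  walk S x z l -> k * mdist x z <= l.
Proof.
move=> kS k0; elim=> [y|{}x y {}z s {}l xy _ ih]; first by rewrite mdistxx mulr0.
apply: (le_trans (ler_wpM2l k0 (metric_triangle x y z))).
by rewrite mulrDr lerD// kS.
Qed.

Lemma walk_rcons (R : realType) (N : Type) (S : N -> N -> R -> Prop) x y z s l :
  walk S x y l -> S y z s -> walk S x z (l + s).
Proof.
move=> w; elim: w s z => [a|a b c s' {}l ab _ ih] s z yz.
  by rewrite add0r -[s]addr0; apply: walk_cons yz _; exact: walk_nil.
by rewrite -addrA; apply: walk_cons ab _; exact: ih.
Qed.

Section walk_dist.
Context (R : realType) (N : Type) (c : N -> N -> R).
Hypothesis c_ge0 : forall x y, 0 <= c x y.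

Let walk_ge0 x y l : walk (cost_step c) x y l -> 0 <= l.
Proof. by elim=> // {}x {}y z s {}l -> _; apply: addr_ge0. Qed.

Let has_inf_walk p x : has_inf [set l | walk (cost_step c) p x l].
Proof.
split; last by exists 0 => l /walk_ge0.
by exists (c p x + 0); apply: (@walk_cons _ _ _ _ x) => //; exact: walk_nil.
Qed.

Lemma walk_dist_lb p x m :
  (forall l, walk (cost_step c) p x l -> m <= l) -> m <= walk_dist c p x.
Proof. by move=> H; apply: lb_le_inf; [case: (has_inf_walk p x)|exact: H]. Qed.

Lemma walk_dist_ge0 p x : 0 <= walk_dist c p x.
Proof. by apply: walk_dist_lb => l /walk_ge0. Qed.

Lemma walk_dist_le p x l : walk (cost_step c) p x l -> walk_dist c p x <= l.
Proof. by move=> w; apply: ge_inf => //; case: (has_inf_walk p x). Qed.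

Lemma walk_distxx p : walk_dist c p p = 0.
Proof.
apply/eqP; rewrite eq_le walk_dist_ge0 andbT.
by apply: walk_dist_le; exact: walk_nil.
Qed.

Lemma walk_dist_step p x y : walk_dist c p y <= walk_dist c p x + c x y.
Proof.
rewrite -lerBlDr; apply: walk_dist_lb => l w; rewrite lerBlDr.
by apply: walk_dist_le; apply: walk_rcons w _.
Qed.

Lemma walk_dist_lt p x l : walk_dist c p x < l ->
  exists2 l', l' < l & walk (cost_step c) p x l'.
Proof.
move=> hl; have [l' w l'l] := inf_adherent (eps := l - walk_dist c p x)
  ltac:(by rewrite subr_gt0) (has_inf_walk p x).
by exists l' => //; move: l'l; rewrite -/(walk_dist c p x) addrC subrK.
Qed.

End walk_dist.

(** * Hausdorff measure and bi-Lipschitz copies *)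

Lemma hausdorff1_null_cover (R : realType) (M : metricType R) (E : set M) :
  hausdorff1 E = 0%E -> forall eta : R, 0 < eta -> exists U : (set M)^nat,
    E `<=` \bigcup_i U i /\ (\sum_(0 <= i <oo) diam (U i) < eta%:E)%E.
Proof.
move=> E0 eta eta0.
have : (hausdorff1_delta 1 E < eta%:E)%E.
  apply: (@le_lt_trans _ _ 0%E); last by rewrite lte_fin.
  by rewrite -E0; apply: ereal_sup_ubound; exists 1 => //=.
by move/ereal_inf_lt => [_ [U [_ EU] <-] Ue]; exists U.
Qed.

Lemma diam_ge0 (R : realType) (M : metricType R) (A : set M) : (0 <= diam A)%E.
Proof. by apply: ereal_sup_ubound; left. Qed.

Lemma diam_dist (R : realType) (M : metricType R) (A : set M) x y :
  A x -> A y -> ((mdist x y)%:E <= diam A)%E.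
Proof. by move=> Ax Ay; apply: ereal_sup_ubound; right; exists x => //; exists y. Qed.

(** Each [U i] that meets [E] contributes an interval of radius [C * diam (U i)] about the image of
    one chosen point, hence the factor 2. [Y] is the union of these intervals, since the image
    itself need not be measurable. *)
Lemma lipschitz_image_cover (R : realType) (M : metricType R) (E : set M)
    (U : (set M)^nat) (F : M -> R) (C b : R) :
  E `<=` \bigcup_i U i -> (\sum_(0 <= i <oo) diam (U i) <= b%:E)%E -> 0 < C ->
  (forall x y, E x -> E y -> `|F x - F y| <= C * mdist x y) ->
  exists Y : set R, [/\ measurable Y,
    (lebesgue_measure Y <= (2 * C * b)%:E)%E & F @` E `<=` Y].
Proof.
move=> EU Ub C0 FL.
have Ufin i : (diam (U i) < +oo)%E.
  apply: (le_lt_trans _ (le_lt_trans Ub (ltry _))).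
  have := @nneseries_lim_ge R (fun i => diam (U i)) xpredT 0%N i.+1
    (fun k _ _ => diam_ge0 (U k)).
  apply: le_trans; rewrite big_nat_recr//= leeDr// sume_ge0// => k _.
  exact: diam_ge0.
pose D i := fine (diam (U i)).
have DE i : diam (U i) = (D i)%:E by rewrite fineK// ge0_fin_numE// diam_ge0.
pose I i : set R := match pselect (exists x, (U i `&` E) x) with
  | left h => `[F (sval (cid h)) - C * D i, F (sval (cid h)) + C * D i]%classic
  | right _ => set0 end.
have mI i : measurable (I i).
  by rewrite /I; case: pselect => [h|_]; [exact: measurable_itv|exact: measurable0].
have D0 i : 0 <= D i by rewrite fine_ge0// diam_ge0.
have lI i : (lebesgue_measure (I i) <= (2 * C)%:E * diam (U i))%E.
  rewrite DE -EFinM /I; case: pselect => [h|_]; last first.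
    by rewrite measure0 lee_fin mulr_ge0// mulr_ge0// ltW.
  rewrite lebesgue_measure_itv /= lte_fin; case: ifP => _.
    by rewrite -EFinB lee_fin; lra.
  by rewrite lee_fin mulr_ge0// mulr_ge0// ltW.
exists (\bigcup_i I i); split; first exact: bigcupT_measurable.
  have := generalized_Boole_inequality (@lebesgue_measure R) mI
    (bigcupT_measurable _ mI).
  move/le_trans; apply.
  apply: (@le_trans _ _ (\sum_(0 <= i <oo) ((2 * C)%:E * diam (U i)))%E).
    by apply: lee_nneseries => // i _; exact: lI.
  rewrite nneseriesZl; last by move=> i _; exact: diam_ge0.
  by rewrite (EFinM (2 * C)) lee_wpmul2l// lee_fin mulr_ge0// ltW.
move=> _ [x Ex <-]; have [i _ Uix] := EU x Ex; exists i => //.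
rewrite /I; case: pselect => [h|]; last by case; exists x.
case: cid => y [Uy Ey] /=; rewrite in_itv /=.
have := FL _ _ Ex Ey; have : C * mdist x y <= C * D i.
  by rewrite ler_pM2l// -lee_fin -DE; exact: diam_dist.
move=> h1 h2; have := le_trans h2 h1; rewrite ler_norml => /andP[? ?].
by apply/andP; split; lra.
Qed.

Lemma hausdorff_null_image (R : realType) (M : metricType R) (E : set M)
    (F : M -> R) (C : R) : hausdorff1 E = 0%E -> 0 < C ->
  (forall x y, E x -> E y -> `|F x - F y| <= C * mdist x y) ->
  forall eta : R, 0 < eta -> exists Y : set R,
    [/\ measurable Y, (lebesgue_measure Y <= eta%:E)%E & F @` E `<=` Y].
Proof.
move=> E0 C0 FL eta eta0.
have eC : 0 < eta / (2 * C) by rewrite divr_gt0// mulr_gt0.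
have [U [EU /ltW Ue]] := hausdorff1_null_cover E0 eC.
have -> : eta = 2 * C * (eta / (2 * C)) by field; rewrite gt_eqF.
exact: lipschitz_image_cover EU Ue C0 FL.
Qed.

Definition seq_complete (R : realType) (N : metricType R) : Prop :=
  forall u : nat -> N,
    (forall e : R, 0 < e -> exists n0, forall i j,
       (n0 <= i)%N -> (n0 <= j)%N -> mdist (u i) (u j) < e) ->
    exists l, forall e : R, 0 < e -> exists n0, forall n,
      (n0 <= n)%N -> mdist (u n) l < e.

(* The form in which pure 1-unrectifiability is transported to bi-Lipschitz
   copies. [P] is the graph of a 2-Lipschitz curve fragment. *)
Definition null_fragments (R : realType) (N : metricType R) : Prop :=
  forall P : set (R * N),
    (forall u v, P u -> P v -> mdist u.2 v.2 <= 2 * `|u.1 - v.1|) ->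
    forall (p : N) (eta : R), 0 < eta -> exists Y : set R,
      [/\ measurable Y, (lebesgue_measure Y <= eta%:E)%E &
        forall u, P u -> Y (mdist p u.2)].

Lemma complete_metric_seq (R : realType) (M : metricType R) :
  complete_metric M -> seq_complete M.
Proof.
move=> cM u cu; have cF : cauchy (u @ \oo).
  apply: cauchy_exP => e e0; have [n H] := cu e e0.
  by exists (u n), n => // k /= nk; rewrite ballEmdist /=; exact: H.
have [l ul] := cM _ _ cF.
exists l => e e0.
have /ul[n _ H] : nbhs l (ball l e) by exact: nbhsx_ballx.
by exists n => k nk; have := H k nk; rewrite /= ballEmdist /= metric_sym.
Qed.

Lemma seq_closed (R : realType) (M : metricType R) (K : set M) (u : nat -> M) l :
  closed K -> (forall n, K (u n)) ->
  (forall e : R, 0 < e -> exists n, mdist (u n) l < e) -> K l.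
Proof.
move=> cK Ku ul; apply: cK => B /nbhs_ballP[e e0 eB]; have [n un] := ul e e0.
by exists (u n); split => //; apply: eB; rewrite ballEmdist /= metric_sym.
Qed.

Section bilipschitz.
Context (R : realType) (M N : metricType R) (K : set M).
Hypothesis MN : bilipschitz_copy N K.

Lemma bilipschitz_copy_inverse : exists (phi : M -> N) (sigma : N -> M) (c C : R),
  [/\ 0 < c, 0 < C, forall x, K (sigma x) /\ phi (sigma x) = x,
      forall x y, c * mdist (sigma x) (sigma y) <= mdist x y &
      forall p q, K p -> K q -> mdist (phi p) (phi q) <= C * mdist p q].
Proof.
have [phi [c [C [[_ _ surj] c0 cC phiL]]]] := MN.
have sE (x : N) : exists y, K y /\ phi y = x.
  by have [y Ky <-] := surj x I; exists y.
have [sigma sP] := choice sE.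
exists phi, sigma, c, C; split => //.
- exact: (lt_trans c0 cC).
- move=> x y; have [Kx ex] := sP x; have [Ky ey] := sP y.
  by have /andP[h _] := phiL _ _ Kx Ky; rewrite ex ey in h.
- by move=> p q Kp Kq; have /andP[_ h] := phiL _ _ Kp Kq.
Qed.

Lemma bilipschitz_copy_complete :
  complete_metric M -> closed K -> seq_complete N.
Proof.
move=> /complete_metric_seq cM cK u cu.
have [phi [sigma [c [C [c0 C0 sK sL pL]]]]] := bilipschitz_copy_inverse.
have [e e0|l ul] := cM (sigma \o u).
  have [n H] := cu (c * e) (mulr_gt0 c0 e0); exists n => i j ni nj.
  by rewrite -(ltr_pM2l c0); apply: le_lt_trans (sL _ _) _; exact: H.
have Kl : K l.
  apply: (seq_closed (u := sigma \o u)) => // [n|e e0]; first exact: (sK _).1.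
  by have [n H] := ul e e0; exists n; exact: H.
exists (phi l) => e e0; have [n H] := ul _ (divr_gt0 e0 C0); exists n => k nk.
rewrite -{1}(sK (u k)).2; apply: le_lt_trans (pL _ _ (sK _).1 Kl) _.
by rewrite mulrC -ltr_pdivlMr//; exact: H.
Qed.

(** A selection [g] of the fragment [P], followed by [sigma], is Lipschitz into [M], so its image is
    null. On that image [mdist p] composed with [phi] is Lipschitz, so its values lie in a small
    set. *)
Lemma bilipschitz_copy_null_fragments :
  purely_1_unrectifiable M -> null_fragments N.
Proof.
move=> pu P PL p eta eta0.
have [phi [sigma [c [C [c0 C0 sK sL pL]]]]] := bilipschitz_copy_inverse.
have [g gP] := choice (fun t : R => match pselect (exists x, P (t, x)) with
  | left h => let: ex_intro x hx := h in
      ex_intro (fun x => (exists x, P (t, x)) -> P (t, x)) x (fun _ => hx)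
  | right h => ex_intro _ p (fun h' => False_ind _ (h h')) end).
pose A : set R := [set t | exists x, P (t, x)].
have H0 : hausdorff1 ((sigma \o g) @` A) = 0%E.
  apply: pu; exists (2 / c) => s t As At /=.
  rewrite mulrAC ler_pdivlMr// mulrC; apply: le_trans (sL _ _) _.
  exact: (PL (s, g s) (t, g t) (gP _ As) (gP _ At)).
have FL x y : ((sigma \o g) @` A) x -> ((sigma \o g) @` A) y ->
    `|mdist p (phi x) - mdist p (phi y)| <= C * mdist x y.
  move=> [s As <-] [t At <-] /=; apply: le_trans (pL _ _ (sK _).1 (sK _).1).
  rewrite !(sK _).2 ler_norml; have := metric_triangle p (g s) (g t).
  have := metric_triangle p (g t) (g s); rewrite (metric_sym (g t) (g s)) => ? ?.
  by apply/andP; split; lra.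
have [Y [mY lY YE]] := hausdorff_null_image H0 C0 FL eta0.
exists Y; split => // -[t x] Ptx; apply: YE => /=.
have At : A t by exists x.
exists (sigma (g t)); first by exists t.
(* Two points of [P] with the same time are at distance 0, so the selection misses no point of
   [P]. *)
rewrite (sK _).2; suff -> : g t = x by [].
apply: mdist_positivity; apply/eqP; rewrite eq_le mdist_ge0 andbT.
by have := PL _ _ (gP _ At) Ptx; rewrite /= subrr normr0 mulr0.
Qed.

End bilipschitz.

(** * Nested chains and curve fragments *)

Definition btw (R : realType) (a b r : R) : bool :=
  (a <= r <= b) || (b <= r <= a).

Lemma btw_split (R : realType) (a b c r : R) :
  btw a c r -> btw a b r \/ btw b c r.
Proof.
rewrite /btw => /orP[] /andP[h1 h2]; have /orP[h|h] := le_total r b.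
- by left; rewrite h1 h.
- by right; rewrite h h2.
- by right; rewrite h h1 orbT.
- by left; rewrite h2 h orbT.
Qed.

Lemma btwE (R : realType) (a b : R) :
  [set r | btw a b r] = `[Num.min a b, Num.max a b]%classic.
Proof.
rewrite /btw; apply/seteqP; split => r /=; rewrite in_itv /=;
  case: (leP a b) => ab.
- by case/orP => // /andP[br ra]; rewrite (le_trans ab br) (le_trans ra ab).
- case/orP => // /andP[ar rb].
  by rewrite (le_trans (ltW ab) ar) (le_trans rb (ltW ab)).
- by move=> ->.
- by move=> ->; rewrite orbT.
Qed.

Lemma btw_measurable (R : realType) (a b : R) : measurable [set r | btw a b r].
Proof. by rewrite btwE; exact: measurable_itv. Qed.

Lemma btw_measure (R : realType) (a b : R) :
  lebesgue_measure [set r | btw a b r] = `|a - b|%:E.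
Proof.
rewrite btwE lebesgue_measure_itv /= lte_fin.
by case: (ltgtP a b) => ab; rewrite ?ab -?EFinB ?ltxx ?subrr ?normr0 //;
  [rewrite distrC|]; rewrite gtr0_norm ?subr_gt0.
Qed.

(* A chain starts at a point of [T] and is continued by points flagged by a
   boolean; the flag of a point concerns the step that ends there. *)
Section chains.
Context (T : Type) (P : T -> T * bool -> Prop).
Implicit Types (u a : T) (v : T * bool) (s : seq (T * bool)).

Fixpoint chain u s : Prop :=
  if s is v :: s' then P u v /\ chain v.1 s' else True.

Fixpoint chain_step u s a v : Prop :=
  if s is w :: s' then (a = u /\ v = w) \/ chain_step w.1 s' a v else False.

Definition chain_end u s : T := last u (map fst s).

Lemma chain_cat u s1 s2 :
  chain u (s1 ++ s2) <-> chain u s1 /\ chain (chain_end u s1) s2.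
Proof.
by elim: s1 u => [|v s1 ih] u /=; rewrite ?ih; [split => // -[]|rewrite and_assoc].
Qed.

Lemma chain_step_cat u s1 s2 a v : chain_step u (s1 ++ s2) a v <->
  chain_step u s1 a v \/ chain_step (chain_end u s1) s2 a v.
Proof.
elim: s1 u => [|w s1 ih] u /=; first by split; [right|case].
by rewrite ih or_assoc.
Qed.

Lemma chain_end_cat u s1 s2 :
  chain_end u (s1 ++ s2) = chain_end (chain_end u s1) s2.
Proof. by rewrite /chain_end map_cat last_cat. Qed.

Lemma chain_stepP u s a v : chain u s -> chain_step u s a v -> P a v.
Proof.
by elim: s u => [//|w s ih] u /= [uw ws] [[-> ->]//|]; exact: ih.
Qed.

End chains.

(** A discrete intermediate value property: split the range at the first vertex and continue with
    the part that contains [r]. *)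
Lemma chain_btw (R : realType) (T : Type) (psi : T -> R) u s r : s <> [::] ->
  btw (psi u) (psi (chain_end u s)) r ->
  exists a v, chain_step u s a v /\ btw (psi a) (psi v.1) r.
Proof.
elim: s u => [//|v s ih] u _ /=; rewrite /chain_end /= -/(chain_end v.1 s).
move=> /(btw_split (psi v.1)) [uv|vs].
  by exists u, v; split => //; left.
case: s ih vs => [_|w s ih vs]; last first.
  by have [//|a [x [ax r_ax]]] := ih v.1 _ vs; exists a, x; split => //; right.
(* No step follows [v], so [r] is the value at [v] itself, an end of the step from [u]. *)
rewrite /chain_end /= /btw orbb => vr.
exists u, v; split; first by left.
have -> : psi v.1 = r by apply/eqP; rewrite eq_le.
by rewrite /btw lexx andbT; exact: le_total.
Qed.

Section fragment.
Context (R : realType) (N : metricType R) (G : N -> N -> Prop)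
  (Phi : N -> N -> R) (theta : R).
Hypothesis Phi_ge : forall x y, G x y -> mdist x y <= 2 * Phi x y.
Hypothesis theta_ge0 : 0 <= theta.
Hypothesis theta_lt1 : theta < 1.

(** A step that pays its full distance is final. A discounted one must again be a pair of [G], at a
    scale smaller by [theta], so that it can be refined in turn. *)
Definition refining_step (p q x y : N) (s : R) : Prop :=
  s = mdist x y \/
  [/\ G x y, mdist x y <= theta * mdist p q & s = Phi x y].

Hypothesis refinable : forall p q, G p q -> forall l, Phi p q < l ->
  exists2 l', l' < l & walk (refining_step p q) p q l'.

Local Notation pt := (R * N)%type.
Implicit Types (u a b : pt) (v w : pt * bool) (s : seq (pt * bool)) (D : R).

(* A pair (t, x) is a point with a time; a step flagged [true] is still to be
   refined, the others are kept for ever. *)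
Definition labelled_step D u v : Prop :=
  if v.2 then [/\ G u.2 v.1.2, Phi u.2 v.1.2 < v.1.1 - u.1 &
                  mdist u.2 v.1.2 <= D]
  else mdist u.2 v.1.2 <= v.1.1 - u.1.

(** The factor 2 comes from the steps still to be refined: their duration is only known to exceed
    [Phi], which is at least half of the distance. *)
Let labelled_le D u v : labelled_step D u v ->
  mdist u.2 v.1.2 <= 2 * (v.1.1 - u.1).
Proof.
rewrite /labelled_step; case: v.2 => [[g ph _]|d].
  by apply: (le_trans (Phi_ge g)); rewrite ler_pM2l// ltW.
by have := mdist_ge0 u.2 v.1.2; lra.
Qed.

Let labelled_mono D u v : labelled_step D u v -> u.1 <= v.1.1.
Proof. by move/labelled_le; have := mdist_ge0 u.2 v.1.2; lra. Qed.

Lemma walk_chain p q x z l : walk (refining_step p q) x z l ->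
  forall t t', l < t' - t -> exists s,
    [/\ chain (labelled_step (theta * mdist p q)) (t, x) s,
        chain_end (t, x) s = (t', z) & s <> [::]].
Proof.
elim=> [{}x|{}x y {}z d {}l xy _ ih] t t' tt'.
  (* The remaining time is spent waiting at [x], which also makes the chain nonempty. *)
  exists [:: ((t', x), false)]; split => //=; split => //.
  by rewrite /labelled_step /= mdistxx ltW.
(* Half of the slack goes to the first step, so that both this step and the rest of the walk keep a
   strictly positive slack. *)
have [|s [s1 s2 _]] := ih (t + d + (t' - t - d - l) / 2) t'; first by lra.
pose y' := (t + d + (t' - t - d - l) / 2, y).
have [dE|[g dth dE]] := xy.
  exists ((y', false) :: s); split => //=; split => //.
  by rewrite /labelled_step /=; lra.
exists ((y', true) :: s); split => //=; split => //.
by rewrite /labelled_step /=; split => //; lra.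
Qed.

Lemma refine_step D u v : labelled_step D u v -> exists s,
  [/\ chain (labelled_step (theta * D)) u s, chain_end u s = v.1, s <> [::] &
      v.2 = false -> s = [:: v]].
Proof.
case: u v => [t x] [[t' y] []] uv; last first.
  by exists [:: ((t', y), false)]; split => //=; split.
have [g ph dD] := uv; have [l lph w] := refinable g ph.
have [s [s1 s2 s0]] := walk_chain w lph.
exists s; split => //.
have dD' : theta * mdist x y <= theta * D by exact: ler_wpM2l.
move: s1; rewrite /=; move: (theta * mdist x y) dD' => c cD.
elim: s (t, x) {s2 s0 uv g ph dD w lph} => [//|[[a b] f] s ih] [d e] /= [h hs].
split; last exact: (ih (a, b) hs).
move: h; rewrite /labelled_step /=; case: f => // -[? ? ?]; split => //.
exact: (le_trans _ cD).
Qed.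

(** Refine every step and concatenate. Old points survive, so the fragments grow; kept steps
    survive, so the bad sets grow; and a value crossed by a step is crossed, by [chain_btw], by one
    of the steps that replace it, which starts no earlier. The last point makes the times of nested
    steps monotone. *)
Lemma refine_chain D u s : s <> [::] -> chain (labelled_step D) u s ->
  exists s', [/\ chain (labelled_step (theta * D)) u s',
    chain_end u s' = chain_end u s /\ s' <> [::],
    forall a v, chain_step u s a v -> exists w, chain_step u s' a w,
    forall a v, chain_step u s a v -> v.2 = false -> chain_step u s' a v &
    forall p r a v, chain_step u s a v -> btw (mdist p a.2) (mdist p v.1.2) r ->
      exists b w, [/\ chain_step u s' b w, a.1 <= b.1 &
        btw (mdist p b.2) (mdist p w.1.2) r]].
Proof.
elim: s u => [//|v s ih] u _ /= [uv vs].
have [s1 [c1 e1 n1 f1]] := refine_step uv.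
have mono a w : chain_step u s1 a w -> u.1 <= a.1.
  elim: (s1) u c1 {uv e1 n1 f1 ih vs} => [//|w' s' ih] b /= [bw ws] [[-> _]//|aw].
  by rewrite (le_trans (labelled_mono bw))// ih.
have [s2 [c2 e2 g1 g2 g3]] : exists s2, [/\ chain (labelled_step (theta * D)) v.1 s2,
    chain_end v.1 s2 = chain_end v.1 s,
    forall a w, chain_step v.1 s a w -> exists w', chain_step v.1 s2 a w',
    forall a w, chain_step v.1 s a w -> w.2 = false -> chain_step v.1 s2 a w &
    forall p r a w, chain_step v.1 s a w -> btw (mdist p a.2) (mdist p w.1.2) r ->
      exists b w', [/\ chain_step v.1 s2 b w', a.1 <= b.1 &
        btw (mdist p b.2) (mdist p w'.1.2) r]].
  case: s ih vs => [_ _|w s ih vs]; first by exists [::]; split.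
  by have [//|s2 [? [? _] ? ? ?]] := ih v.1 _ vs; exists s2.
exists (s1 ++ s2); split.
- by apply/chain_cat; rewrite e1.
- by split; [rewrite chain_end_cat e1 e2|case: (s1) n1].
- move=> a w [[-> _]|/g1[w' aw]]; last first.
    by exists w'; apply/chain_step_cat; right; rewrite e1.
  case: (s1) n1 => // w' s' _; exists w'; by left.
- move=> a w [[-> ->]|aw] w0; apply/chain_step_cat; last first.
    by right; rewrite e1; exact: g2.
  by left; rewrite (f1 w0) /=; left.
- move=> p r a w [[-> ->]|aw] r_aw.
    move: r_aw; rewrite -e1 => /(chain_btw (psi := fun a => mdist p a.2) n1)[b [w' [bw rb]]].
    exists b, w'; split => //; last exact: mono bw.
    by apply/chain_step_cat; left.
  have [b [w' [bw ab rb]]] := g3 p r a w aw r_aw.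
  by exists b, w'; split => //; apply/chain_step_cat; right; rewrite e1.
Qed.

Lemma chain_lipschitz D u s a v b w : chain (labelled_step D) u s ->
  chain_step u s a v -> chain_step u s b w ->
  mdist a.2 b.2 <= 2 * `|a.1 - b.1|.
Proof.
have head u' s' c x : chain (labelled_step D) u' s' -> chain_step u' s' c x ->
    mdist u'.2 c.2 <= 2 * (c.1 - u'.1).
  elim: s' u' => [//|y s' ih] u' /= [uy ys] [[-> _]|cx].
    by rewrite mdistxx subrr mulr0.
  apply: (le_trans (metric_triangle _ y.1.2 _)).
  by have := ih _ ys cx; have := labelled_le uy; lra.
have head' u' s' c x : chain (labelled_step D) u' s' -> chain_step u' s' c x ->
    mdist u'.2 c.2 <= 2 * `|u'.1 - c.1|.
  move=> us cx; apply: (le_trans (head _ _ _ _ us cx)).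
  by rewrite ler_pM2l// distrC ler_norm.
move=> us av bw; elim: s u us av bw => [//|x s ih] u /= [ux xs].
move=> [[-> _]|av] [[-> _]|bw]; last exact: (ih x.1).
- by rewrite mdistxx mulr_ge0.
- by apply: (head' _ (x :: s) _ w) => /=; [split|right].
- rewrite distrC [mdist _ _]metric_sym.
  by apply: (head' _ (x :: s) _ v) => /=; [split|right].
Qed.

(** Kept steps are jumps of the limit fragment, so nothing forces [mdist p] to take on the fragment
    the values that they cross. *)
Definition bad_set (p : N) u s : set R :=
  [set r | exists a v, [/\ chain_step u s a v, v.2 = false &
    btw (mdist p a.2) (mdist p v.1.2) r]].

(** A kept step changes [mdist p] by at most its length, hence by at most its duration, and the
    durations add up to the whole time span. *)
Lemma bad_set_measure p D u s : chain (labelled_step D) u s ->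
  measurable (bad_set p u s) /\
  (lebesgue_measure (bad_set p u s) <= ((chain_end u s).1 - u.1)%:E)%E.
Proof.
elim: s u => [|v s ih] u.
  move=> _; have -> : bad_set p u [::] = set0.
    by apply/seteqP; split => // r [a [v []]].
  by rewrite measure0 /chain_end /= subrr.
move=> /= [uv /ih[mB lB]].
have -> : bad_set p u (v :: s) =
    (if v.2 then set0 else [set r | btw (mdist p u.2) (mdist p v.1.2) r])
      `|` bad_set p v.1 s.
  apply/seteqP; split => [r [a [w [/= [[-> ->]|aw] w0 r_aw]]]|r [|]].
  - by left; rewrite w0.
  - by right; exists a, w.
  - by case: ifPn => // /negPf v0 r_uv; exists u, v; split => //; left.
  - by move=> [a [w [aw w0 r_aw]]]; exists a, w; split => //; right.
have mA : measurable (if v.2 then set0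
    else [set r | btw (mdist p u.2) (mdist p v.1.2) r]).
  by case: ifP => _; [exact: measurable0|exact: btw_measurable].
split; first exact: measurableU.
have := measureU2 (@lebesgue_measure R) mA mB.
move/le_trans; apply; rewrite /chain_end /= -/(chain_end v.1 s).
have -> : (chain_end v.1 s).1 - u.1 = (v.1.1 - u.1) + ((chain_end v.1 s).1 - v.1.1).
  by ring.
rewrite EFinD; apply: leeD => //; case: ifPn => [_|/negPf v0].
  by rewrite measure0 lee_fin subr_ge0 (labelled_mono uv).
rewrite [leLHS]btw_measure lee_fin; move: uv; rewrite /labelled_step v0.
apply: le_trans; rewrite ler_norml.
have := metric_triangle p u.2 v.1.2; have := metric_triangle p v.1.2 u.2.
by rewrite (metric_sym v.1.2 u.2) => ? ?; apply/andP; split; lra.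
Qed.

Lemma chain_step_le D u s a v : chain (labelled_step D) u s ->
  chain_step u s a v -> a.1 <= (chain_end u s).1.
Proof.
elim: s u => [//|w s ih] u /= [uw ws]; rewrite /chain_end /= -/(chain_end w.1 s).
case=> [[-> _]|aw]; last exact: ih.
apply: (le_trans (labelled_mono uw)); elim: (s) w.1 ws => [//|x r ihr] b /= [bx xr].
by rewrite /chain_end /= -/(chain_end x.1 r) (le_trans (labelled_mono bx))// ihr.
Qed.

Lemma bad_sets_measure (B : nat -> set R) (l : R) :
  (forall n, measurable (B n) /\ (lebesgue_measure (B n) <= l%:E)%E) ->
  (forall n, B n `<=` B n.+1) ->
  (lebesgue_measure (\bigcup_n B n) <= l%:E)%E.
Proof.
move=> mB BS; have mB1 n := (mB n).1.
have homB : {homo B : n m / (n <= m)%N >-> (n <= m)%O}.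
  move=> n m nm; rewrite subsetEset; elim: m nm => [|m ih].
    by rewrite leqn0 => /eqP ->.
  rewrite leq_eqVlt => /predU1P[-> //|]; rewrite ltnS => /ih h.
  exact: subset_trans h (BS m).
have cv := nondecreasing_cvg_mu (mu := @lebesgue_measure R) mB1
  (bigcupT_measurable _ mB1) homB.
by apply: (cvge_le _ cv); near=> n; exact: (mB n).2.
Unshelve. all: by end_near.
Qed.

(* Otherwise refine the one-step chain from p to q over and over: the values of
   mdist p taken along the limit points of the chains are [0, mdist p q], up to a
   set of measure at most l0, which is smaller than mdist p q. *)
Theorem fragment_bound : seq_complete N -> null_fragments N ->
  forall p q, G p q -> mdist p q <= Phi p q.
Proof.
move=> cN nN p0 q0 g0; rewrite leNgt; apply/negP => phd.
set D0 := mdist p0 q0 in phd.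
(* The time span [l0] exceeds [Phi p0 q0], as the first labelled step requires, and stays below the
   distance to be covered. *)
pose l0 := (Phi p0 q0 + D0) / 2.
have phl : Phi p0 q0 < l0 by rewrite /l0; lra.
have l0D : l0 < D0 by rewrite /l0; lra.
pose u0 : pt := (0, p0); pose psi (a : pt) := mdist p0 a.2.
have [f fP] := choice (fun x : R * seq (pt * bool) =>
  let Q s' := chain (labelled_step x.1) u0 x.2 -> x.2 <> [::] ->
   [/\ chain (labelled_step (theta * x.1)) u0 s',
    chain_end u0 s' = chain_end u0 x.2 /\ s' <> [::],
    forall a v, chain_step u0 x.2 a v -> exists w, chain_step u0 s' a w,
    forall a v, chain_step u0 x.2 a v -> v.2 = false -> chain_step u0 s' a v &
    forall p r a v, chain_step u0 x.2 a v ->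
        btw (mdist p a.2) (mdist p v.1.2) r ->
      exists b w, [/\ chain_step u0 s' b w, a.1 <= b.1 &
        btw (mdist p b.2) (mdist p w.1.2) r]] in
  match pselect (x.2 <> [::] /\ chain (labelled_step x.1) u0 x.2) with
  | left h => let: ex_intro s' hs := refine_chain h.1 h.2 in
      ex_intro Q s' (fun _ _ => hs)
  | right h => ex_intro Q [::] (fun h1 h2 => False_ind _ (h (conj h2 h1)))
  end).
pose D n := theta ^+ n * D0.
pose s := fix s n := if n is n'.+1 then f (D n', s n')
  else [:: ((l0, q0), true)].
have DS n : D n.+1 = theta * D n by rewrite /D exprS mulrA.
have sP n : [/\ chain (labelled_step (D n)) u0 (s n),
    chain_end u0 (s n) = (l0, q0) & s n <> [::]].
  elim: n => [|n [s1 s2 s3]].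
    split => //=; split => //; rewrite /labelled_step /= subr0; split => //.
    by rewrite /D expr0 mul1r.
  by have [h1 [h2 h3] _ _ _] := fP (D n, s n) s1 s3; rewrite DS /= h2; split.
have sS n := let: And3 h1 _ h3 := sP n in fP (D n, s n) h1 h3.
pose B n := bad_set p0 u0 (s n).
have BP n : measurable (B n) /\ (lebesgue_measure (B n) <= l0%:E)%E.
  have [h1 h2 _] := sP n; have := bad_set_measure p0 h1.
  by rewrite h2 /= subr0.
have BS n : B n `<=` B n.+1.
  move=> r [a [v [av v0 rv]]]; exists a, v; split => //.
  by have [_ _ _ h _] := sS n; exact: h.
pose P : set pt := [set a | exists n w, chain_step u0 (s n) a w].
have step_le n m a w : (n <= m)%N -> chain_step u0 (s n) a w ->
    exists w', chain_step u0 (s m) a w'.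
  move=> nm aw; elim: m nm => [|m ih].
    by rewrite leqn0 => /eqP n0; exists w; rewrite -n0.
  rewrite leq_eqVlt => /predU1P[<-|]; first by exists w.
  by rewrite ltnS => /ih[w' aw']; have [_ _ h _ _] := sS m; exact: h aw'.
have PL a b : P a -> P b -> mdist a.2 b.2 <= 2 * `|a.1 - b.1|.
  move=> [n [v av]] [m [w bw]].
  have [v' av'] := step_le _ _ _ _ (leq_maxl n m) av.
  have [w' bw'] := step_le _ _ _ _ (leq_maxr n m) bw.
  by have [h1 _ _] := sP (maxn n m); exact: chain_lipschitz h1 av' bw'.
(* The closure of [P]: it is still 2-Lipschitz and contains the limits of the nested steps. *)
pose Q : set pt := [set c | forall e : R, 0 < e -> exists a,
  [/\ P a, `|c.1 - a.1| < e & mdist c.2 a.2 < e]].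
have QL a b : Q a -> Q b -> mdist a.2 b.2 <= 2 * `|a.1 - b.1|.
  move=> Qa Qb; apply/ler_addgt0Pr => e e0.
  have e6 : 0 < e / 6 by rewrite divr_gt0.
  have [a' [Pa' t1 x1]] := Qa _ e6; have [b' [Pb' t2 x2]] := Qb _ e6.
  have h1 := metric_triangle a.2 a'.2 b.2; have h2 := metric_triangle a'.2 b'.2 b.2.
  have h3 := PL _ _ Pa' Pb'; rewrite [mdist b'.2 _]metric_sym in h2.
  have h4 : `|a'.1 - b'.1| <= `|a.1 - a'.1| + `|a.1 - b.1| + `|b.1 - b'.1|.
    have -> : a'.1 - b'.1 = - (a.1 - a'.1) + (a.1 - b.1) + (b.1 - b'.1) by ring.
    by rewrite (le_trans (ler_normD _ _))// lerD2r (le_trans (ler_normD _ _))// normrN.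
  by lra.
have eta0 : 0 < (D0 - l0) / 2 by lra.
have [Y [mY lY QY]] := nN Q QL p0 _ eta0.
have D0_ge0 : 0 <= D0 by exact: mdist_ge0.
(* If [r] is in no bad set, the nested steps that cross it are discounted at every stage; they
   shrink to a point of [Q] at distance [r] from [p0]. *)
have cover : `[0, D0]%classic `<=` (\bigcup_n B n) `|` Y.
  move=> r /=; rewrite in_itv /= => rD.
  have [|nB] := pselect ((\bigcup_n B n) r); [by left|right].
  have [h hP] := choice (fun x : nat * (pt * (pt * bool)) =>
    let T (w : pt * (pt * bool)) := chain_step u0 (s x.1) x.2.1 x.2.2 ->
      btw (psi x.2.1) (psi x.2.2.1) r ->
      [/\ chain_step u0 (s x.1.+1) w.1 w.2, x.2.1.1 <= w.1.1 &
        btw (psi w.1) (psi w.2.1) r] in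
    match pselect (chain_step u0 (s x.1) x.2.1 x.2.2 /\
       btw (psi x.2.1) (psi x.2.2.1) r) with
    | left e => let: And5 _ _ _ _ e5 := sS x.1 in
       let: ex_intro b (ex_intro w e6) := e5 _ _ _ _ e.1 e.2 in
       ex_intro T (b, w) (fun _ _ => e6)
    | right e => ex_intro T x.2 (fun e1 e2 => False_ind _ (e (conj e1 e2)))
    end).
  pose z := fix z n := if n is n'.+1 then h (n', z n') else (u0, ((l0, q0), true)).
  have zP n : chain_step u0 (s n) (z n).1 (z n).2 /\
      btw (psi (z n).1) (psi (z n).2.1) r.
    elim: n => [|n [z1 z2]].
      by split; [left|rewrite /btw /psi /= mdistxx rD].
    by have [] := hP (n, z n) z1 z2.
  have zS n : (z n).1.1 <= (z n.+1).1.1.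
    by have [z1 z2] := zP n; have [] := hP (n, z n) z1 z2.
  pose t n := (z n).1.1.
  (* The starting times are nondecreasing and at most [l0]; by [PL] their convergence makes the
     starting points a Cauchy sequence. *)
  have tcv : cvgn t.
    apply: nondecreasing_is_cvgn; first by apply/nondecreasing_seqP.
    exists l0 => _ [n _ <-]; have [h1 h2 _] := sP n.
    by have := chain_step_le h1 (zP n).1; rewrite h2.
  have tl e : 0 < e -> exists n0, forall n, (n0 <= n)%N -> `|limn t - t n| < e.
    by move=> e0; move/cvgrPdist_lt : tcv => /(_ e e0)[n0 _ H]; exists n0.
  have Pz n : P (z n).1 by exists n, (z n).2; exact: (zP n).1.
  have [x xl] : exists x, forall e : R, 0 < e -> exists n0, forall n,
      (n0 <= n)%N -> mdist (z n).1.2 x < e.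
    apply: cN => e e0; have [|n0 H] := tl (e / 4); first by lra.
    exists n0 => i j /H hi /H hj; apply: (le_lt_trans (PL _ _ (Pz i) (Pz j))).
    have -> : (z i).1.1 - (z j).1.1 = - (limn t - t i) + (limn t - t j).
      by rewrite /t; ring.
    have := ler_normD (- (limn t - t i)) (limn t - t j); rewrite normrN; lra.
  have Qx : Q (limn t, x).
    move=> e e0; have [n1 H1] := tl _ e0; have [n2 H2] := xl _ e0.
    exists (z (maxn n1 n2)).1; split => //=; first by apply: H1; exact: leq_maxl.
    by rewrite metric_sym; apply: H2; exact: leq_maxr.
  suff -> : r = mdist p0 x by exact: (QY _ Qx).
  apply/eqP; rewrite -subr_eq0 -normr_le0; apply/ler_addgt0Pr => e e0; rewrite add0r.
  have e2 : 0 < e / 2 by lra.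
  have [n1 H1] := xl _ e2.
  have [n2 H2] : exists n2, forall n, (n2 <= n)%N -> D n < e / 2.
    have := @cvg_geometric R D0 theta; rewrite ger0_norm// => /(_ theta_lt1).
    move=> /cvgrPdist_lt/(_ _ e2)[n2 _ H]; exists n2 => n /H.
    by rewrite /geometric /= sub0r normrN mulrC; apply: le_lt_trans; exact: ler_norm.
  pose n := maxn n1 n2.
  have := H1 n (leq_maxl _ _); have := H2 n (leq_maxr _ _).
  have [z1 z2] := zP n; have [s1 _ _] := sP n.
  (* A kept step would put [r] in a bad set, so this one is discounted: its length is at most [D n],
     and [r] lies between the values at its ends. *)
  have := chain_stepP s1 z1; rewrite /labelled_step.
  case: ifPn => [_ [_ _ zD]|/negPf v0]; last first.
    by exfalso; apply: nB; exists n => //; exists (z n).1, (z n).2.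
  have h1 := metric_triangle p0 (z n).1.2 (z n).2.1.2.
  have h2 := metric_triangle p0 (z n).2.1.2 (z n).1.2.
  rewrite (metric_sym (z n).2.1.2) in h2.
  have h3 := metric_triangle p0 (z n).1.2 x.
  have h4 := metric_triangle p0 x (z n).1.2; rewrite (metric_sym x) in h4.
  move: z2; rewrite /psi /btw => /orP[] /andP[? ?] ? ?;
    rewrite ler_norml; apply/andP; split; lra.
have mB := bigcupT_measurable B (fun n => (BP n).1).
have : (lebesgue_measure `[0%R, D0]%classic <=
    lebesgue_measure ((\bigcup_n B n) `|` Y))%E.
  by apply: le_measure => //; rewrite inE; [exact: measurable_itv|exact: measurableU].
apply/negP; rewrite -ltNge lebesgue_measure_itv /= lte_fin.
have D0gt : 0 < D0.
  have := Phi_ge g0; rewrite -/D0; lra.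
rewrite D0gt oppr0 adde0.
apply: (le_lt_trans (measureU2 (@lebesgue_measure R) mB mY)).
apply: (@le_lt_trans _ _ (l0%:E + ((D0 - l0) / 2)%:E)%E).
  by apply: leeD => //; exact: bad_sets_measure.
by rewrite -EFinD lte_fin; lra.
Qed.

End fragment.

(** * Perturbation near a pair *)

(** Both orders are allowed because a slope does not depend on the order of the pair. *)
Definition close_pair (R : realType) (N : metricType R) (delta : R)
    (p q x y : N) : Prop :=
  mdist x p + mdist y q <= delta * mdist p q \/
  mdist x q + mdist y p <= delta * mdist p q.

Lemma close_pair_sym (R : realType) (N : metricType R) (delta : R) (p q x y : N) :
  close_pair delta p q x y -> close_pair delta p q y x.
Proof. by rewrite /close_pair ![mdist x _ + _]addrC => -[]; [right|left]. Qed.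

Section perturbation.
Context (R : realType) (N : metricType R) (Y : normedModType R).
Context (f : N -> Y) (m eps delta : R).
Hypothesis f_ge : forall x y, m * mdist x y <= `|f x - f y|.
Hypotheses (eps0 : 0 < eps) (eps_m : eps < m) (delta0 : 0 < delta)
  (delta1 : delta <= 1).

Let alpha := delta / 4.

(* [eps] times this is the least amount by which [f] may contract the pair once
   its slopes are only required to be at least [m - eps * (1 - alpha)]. *)
Let Phi x y := (1 - alpha) * mdist x y + (`|f x - f y| - m * mdist x y) / eps.

Let G x y := Phi x y < mdist x y.

(** Close pairs get no discount: there the perturbation may contract [f] at the full rate [eps]. *)
Let cost p q x y :=
  if `[< close_pair delta p q x y >] then mdist x y
  else Num.min (mdist x y) (Phi x y).

Let Phi_sym x y : Phi x y = Phi y x.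
Proof. by rewrite /Phi distrC metric_sym. Qed.

Let Phi_ge x y : (1 - alpha) * mdist x y <= Phi x y.
Proof. by rewrite /Phi lerDl mulr_ge0 ?subr_ge0// invr_ge0 ltW. Qed.

Let Phi_ge0 x y : 0 <= Phi x y.
Proof.
apply: le_trans (Phi_ge x y); rewrite mulr_ge0 ?mdist_ge0// /alpha.
by move: delta1; lra.
Qed.

Let cost_sym p q x y : cost p q x y = cost p q y x.
Proof.
rewrite /cost (Phi_sym x) (metric_sym x).
have -> : `[< close_pair delta p q x y >] = `[< close_pair delta p q y x >] => //.
apply: asbool_equiv_eq; split; apply: close_pair_sym.
Qed.

Let cost_ge p q x y : (1 - alpha) * mdist x y <= cost p q x y.
Proof.
have h : (1 - alpha) * mdist x y <= mdist x y.
  by rewrite ler_piMl ?mdist_ge0// /alpha; move: delta0; lra.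
by rewrite /cost; case: ifP => // _; rewrite le_min h Phi_ge.
Qed.

Let cost_ge0 p q x y : 0 <= cost p q x y.
Proof. by rewrite /cost; case: ifP => _; rewrite ?le_min mdist_ge0 ?Phi_ge0. Qed.

Let cost_le p q x y : cost p q x y <= mdist x y.
Proof. by rewrite /cost; case: ifP => // _; rewrite ge_min lexx. Qed.

Let theta := 1 - delta / 2.

(** Here [a] stands for the cost already spent from [p] to [x]. A discounted step is not close to
    [(p, q)]; were it longer than [theta * mdist p q], the path through [p], [x], [y], [q] would
    have length at least [(1 + delta / 2) * mdist p q]. As every step costs at least [1 - delta / 4]
    times its length, and [(1 - delta / 4) * (1 + delta / 2) >= 1] for [delta <= 1], the walk would
    cost at least [mdist p q]. *)
Let walk_refining p q x z l : walk (cost_step (cost p q)) x z l -> z = q ->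
  forall a, (1 - alpha) * mdist p x <= a -> a + l < mdist p q ->
  walk (refining_step G Phi theta p q) x z l.
Proof.
elim=> [{}x|{}x y {}z s {}l -> yz ih] zq a xa al; first exact: walk_nil.
have xyC := cost_ge p q x y.
have tri := metric_triangle p x y.
have h := walk_ge (k := 1 - alpha) _ _ yz.
have a1 : 0 <= 1 - alpha by rewrite /alpha; move: delta1; lra.
have yzl : (1 - alpha) * mdist y z <= l.
  by apply: h => // b c s' ->; exact: cost_ge.
apply: walk_cons; last first.
  apply: (ih zq (a + cost p q x y)); last by rewrite -addrA.
  by apply: (le_trans (ler_wpM2l a1 tri)); rewrite mulrDr lerD.
rewrite /refining_step /cost; case: asboolP => [_|nr]; first by left.
have [dPhi|Phid] := leP (mdist x y) (Phi x y); first by left.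
right; split => //.
have far : delta * mdist p q < mdist x p + mdist y q.
  by rewrite ltNge; apply/negP => hle; apply: nr; left.
rewrite (metric_sym x p) in far.
have : (1 - alpha) * (mdist p x + mdist x y + mdist y q) < mdist p q.
  by rewrite !mulrDr; move: yzl; rewrite zq; lra.
move: far a1; rewrite /theta /alpha => far a1 hS.
have D0 := mdist_ge0 p q; rewrite leNgt; apply/negP => hxy.
have h1 : (1 - delta / 4) * ((1 + delta / 2) * mdist p q) <=
    (1 - delta / 4) * (mdist p x + mdist x y + mdist y q).
  by apply: ler_wpM2l => //; lra.
have h2 : 0 <= mdist p q * (delta * (2 - delta)).
  by rewrite mulr_ge0// mulr_ge0 ?ltW//; move: delta1; lra.
move: (le_lt_trans h1 hS); apply/negP; rewrite -leNgt; move: h2.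
by clear h1 hxy; lra.
Qed.

(** Either some pair of [G] has walk distance above its [Phi], and the walk distance from [p] is the
    perturbation; or every pair of [G] is refinable, and [fragment_bound] excludes the given
    pair. *)
Lemma perturbation (z : N) : seq_complete N -> null_fragments N ->
  (exists x y, x <> y /\ `|f x - f y| < (m + eps * (delta / 4)) * mdist x y) ->
  exists (g : N -> Y) p q mu,
    [/\ g z = f z,
        forall x y, `|(g x - f x) - (g y - f y)| <= eps * mdist x y,
        mu < m,
        p <> q /\ `|g p - g q| < mu * mdist p q &
        forall x y, `|g x - g y| < mu * mdist x y -> close_pair delta p q x y].
Proof.
move=> cN nN [x0 [y0 [xy0 fxy0]]].
have [[p [q [gpq hpq]]]|none] := pselect (exists p q,
    G p q /\ Phi p q < walk_dist (cost p q) p q); last first.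
  have g0 : G x0 y0.
    (* Belonging to [G] means exactly having slope below [m + eps * alpha]. *)
    rewrite /G /Phi -ltrBrDl ltr_pdivrMr// /alpha; move: fxy0; lra.
  suff : mdist x0 y0 <= Phi x0 y0 by rewrite leNgt => /negP.
  apply: (@fragment_bound R N G Phi theta) => //.
  - move=> x y _; have := Phi_ge x y; have d0 := mdist_ge0 x y.
    have : 0 <= (1 - delta) * mdist x y by rewrite mulr_ge0// subr_ge0.
    by rewrite /alpha; move: delta0 delta1; lra.
  - by rewrite /theta; move: delta0 delta1; lra.
  - by rewrite /theta; move: delta0 delta1; lra.
  - move=> p q gpq l phl.
    (* The walk is also taken cheaper than [mdist p q], so that [walk_refining] applies. *)
    have := walk_dist_lt (cost_ge0 p q) (x := q) (p := p)
      (l := Num.min l (mdist p q)).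
    case.
      rewrite lt_min; have hle : walk_dist (cost p q) p q <= Phi p q.
        by rewrite leNgt; apply/negP => ?; apply: none; exists p, q.
      by rewrite (le_lt_trans hle phl) (le_lt_trans hle gpq).
    move=> l'; rewrite lt_min => /andP[l'l l'd] w; exists l' => //.
    by apply: (walk_refining w erefl (a := 0)); rewrite ?mdistxx ?mulr0 ?add0r.
pose h x := walk_dist (cost p q) p x.
have h_step x y : `|h x - h y| <= cost p q x y.
  have h1 := walk_dist_step (cost_ge0 p q) p x y.
  have h2 := walk_dist_step (cost_ge0 p q) p y x.
  by rewrite cost_sym in h2; rewrite ler_norml /h; apply/andP; split; lra.
have hp : h p = 0 by exact: walk_distxx.
have rho0 : 0 < `|f q - f p|.
  rewrite distrC; apply: lt_le_trans (f_ge p q); rewrite mulr_gt0//.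
    by move: eps0 eps_m; lra.
  by apply: (le_lt_trans (Phi_ge0 p q)).
pose u := `|f q - f p|^-1 *: (f q - f p).
have u1 : `|u| = 1.
  by rewrite normrZ ger0_norm ?invr_ge0// mulVf// gt_eqF.
pose g x := f x - (eps * (h x - h z)) *: u.
have gE x y : g x - g y = (f x - f y) - (eps * (h x - h y)) *: u.
  have -> : eps * (h x - h y) = eps * (h x - h z) - eps * (h y - h z) by ring.
  rewrite /g scalerBl opprB; move: (_ *: u) (_ *: u) => a b.
  by rewrite opprB addrACA [- _ - _]addrC addrACA.
(* Since [eps * Phi x y] is [|f x - f y|] minus this number times [mdist x y], an increment of [h]
   at most [Phi] keeps the slope of [g] at or above it, while [h q > Phi p q] brings the slope at
   [(p, q)] strictly below. *)
exists g, p, q, (m - eps * (1 - alpha)); split.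
- by rewrite /g subrr mulr0 scale0r subr0.
- move=> x y.
  have -> : g x - f x - (g y - f y) = (g x - g y) - (f x - f y).
    move: (g x) (g y) (f x) (f y) => a b c d.
    by rewrite !opprB [d - b]addrC addrACA [- c + _]addrC.
  rewrite gE addrAC subrr add0r normrN normrZ u1 mulr1 normrM gtr0_norm//.
  by rewrite ler_pM2l// (le_trans (h_step x y)).
- by rewrite ltrBlDr ltrDl mulr_gt0// /alpha; move: delta1; lra.
- split.
    by move=> pq; move: rho0; rewrite pq subrr normr0 ltxx.
  rewrite distrC gE hp subr0 /u scalerA.
  have -> : f q - f p - (eps * h q / `|f q - f p|) *: (f q - f p) =
     (1 - eps * h q / `|f q - f p|) *: (f q - f p).
    by rewrite scalerBl scale1r.
  have hq : h q <= mdist p q.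
    by have := h_step q p; rewrite hp subr0 => /ler_normlW/le_trans; apply;
      rewrite cost_sym.
  have fpq := f_ge p q; rewrite distrC in fpq.
  (* The scalar in front of [f q - f p] is thus nonnegative, and the norm drops by exactly
     [eps * h q]. *)
  have eh : eps * h q <= `|f q - f p|.
    apply: le_trans fpq; apply: ler_pM => //; [exact: ltW|exact: walk_dist_ge0|exact: ltW].
  rewrite normrZ ger0_norm; last by rewrite subr_ge0 ler_pdivrMr// mul1r.
  rewrite mulrBl mul1r mulfVK ?gt_eqF//.
  have : eps * Phi p q < eps * h q by rewrite ltr_pM2l.
  rewrite /Phi mulrDr [eps * (_ / _)]mulrC mulfVK ?gt_eqF// distrC; lra.
- move=> x y; rewrite ltNge => /negP hle; have [//|nr] := pselect (close_pair delta p q x y).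
  exfalso; apply: hle; rewrite gE.
  have hc : `|h x - h y| <= Phi x y.
    apply: (le_trans (h_step x y)); rewrite /cost; case: asboolP => // _.
    by rewrite ge_min lexx orbT.
  have := lerB_dist (f x - f y) ((eps * (h x - h y)) *: u).
  rewrite normrZ u1 mulr1 normrM gtr0_norm//.
  have : eps * `|h x - h y| <= eps * Phi x y by rewrite ler_pM2l.
  rewrite /Phi mulrDr [eps * (_ / _)]mulrC mulfVK ?gt_eqF//; lra.
Qed.

End perturbation.

(** * Limits of perturbations *)

Lemma halving_small (R : realType) (r : nat -> R) :
  (forall n, 0 <= r n) -> (forall n, r n.+1 <= r n / 2) ->
  forall (n : nat) (c e : R), 0 <= c -> 0 < e ->
    exists2 k, (n <= k)%N & r k * c < e.
Proof.
move=> r0 rS n c e c0 e0.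
have rk k : r (n + k)%N <= r n * 2^-1 ^+ k.
  elim: k => [|k ih]; first by rewrite addn0 expr0 mulr1.
  by rewrite addnS exprSr mulrA (le_trans (rS _))// ler_wpM2r.
have := @cvg_geometric R (r n * c) 2^-1.
rewrite ger0_norm ?invr_ge0// invf_lt1// ltr1n => /(_ isT).
move=> /cvgrPdist_lt/(_ _ e0)[k _ H]; exists (n + k)%N; first exact: leq_addr.
have := H k (leqnn k); rewrite /geometric /= sub0r normrN => hk.
apply: le_lt_trans (le_lt_trans (ler_norm _) hk).
by rewrite mulrAC ler_wpM2r.
Qed.

(** The bound telescopes because [r k <= 2 * r k - 2 * r k.+1]. *)
Lemma halving_sum (R : realType) (r : nat -> R) (D : nat -> nat -> R) :
  (forall n, 0 <= r n) -> (forall n, r n.+1 <= r n / 2) ->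
  (forall n, D n n <= 0) -> (forall n k, D n k.+1 <= D n k + r k) ->
  forall n k, (n <= k)%N -> D n k <= 2 * r n - 2 * r k.
Proof.
move=> r0 rS D0 DS n k nk; elim: k nk => [|k ih].
  by rewrite leqn0 => /eqP ->; rewrite subrr.
rewrite leq_eqVlt => /predU1P[<-|]; first by rewrite subrr.
by rewrite ltnS => /ih; have := DS n k; have := rS k; lra.
Qed.

Lemma metric_halving_cvg (R : realType) (N : metricType R) (x : nat -> N)
    (r : nat -> R) : seq_complete N ->
  (forall n, 0 <= r n) -> (forall n, r n.+1 <= r n / 2) ->
  (forall n, mdist (x n) (x n.+1) <= r n) ->
  exists l, forall n, mdist (x n) l <= 2 * r n.
Proof.
move=> cN r0 rS xr.
have h n k : (n <= k)%N -> mdist (x n) (x k) <= 2 * r n.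
  move=> nk; have := halving_sum (D := fun i j => mdist (x i) (x j)) r0 rS _ _ nk.
  have := r0 k; set a := mdist _ _ => rk H; have : a <= 2 * r n - 2 * r k.
    apply: H => [i|i j]; first by rewrite mdistxx.
    by rewrite (le_trans (metric_triangle _ (x j) _))// lerD2l.
  by lra.
have [e e0|l xl] := cN x.
  have [//|n _] := halving_small r0 rS 0 (c := 4) _ e0.
  move=> rn; exists n => i j ni nj; apply: le_lt_trans (metric_triangle _ (x n) _) _.
  by rewrite metric_sym; have := h _ _ ni; have := h _ _ nj; lra.
exists l => n; apply/ler_addgt0Pr => e /xl[k H].
have := H (maxn n k) (leq_maxr _ _); have := h n _ (leq_maxl n k).
by have := metric_triangle (x n) (x (maxn n k)) l; lra.
Qed.

Lemma norm_halving_cvg (R : realType) (Y : completeNormedModType R)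
    (x : nat -> Y) (r : nat -> R) :
  (forall n, 0 <= r n) -> (forall n, r n.+1 <= r n / 2) ->
  (forall n, `|x n - x n.+1| <= r n) ->
  exists l, forall n, `|x n - l| <= 2 * r n.
Proof.
move=> r0 rS xr.
have h n k : (n <= k)%N -> `|x n - x k| <= 2 * r n.
  move=> nk; have := halving_sum (D := fun i j => `|x i - x j|) r0 rS _ _ nk.
  have := r0 k; set a := `| _ | => rk H; have : a <= 2 * r n - 2 * r k.
    apply: H => [i|i j]; first by rewrite subrr normr0.
    by rewrite (le_trans (ler_distD (x j) _ _))// lerD2l.
  by lra.
have cx : cvgn x.
  apply/cauchy_cvgP; apply: cauchy_exP => e e0.
  have [//|n _] := halving_small r0 rS 0 (c := 2) _ e0.
  move=> rn; exists (x n); exists n => // k /= nk; rewrite -ball_normE /=.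
  by apply: (le_lt_trans (h _ _ nk)); rewrite mulrC.
exists (limn x) => n; apply/ler_addgt0Pr => e e0.
move/cvgrPdist_lt : cx => /(_ e e0)[k _ H].
have := H (maxn n k) (leq_maxr _ _); have := h n _ (leq_maxl n k).
have := ler_distD (x (maxn n k)) (x n) (limn x).
by rewrite /= (distrC (limn x)); lra.
Qed.

Lemma ler_dist_perturb (R : realType) (Y : normedModType R) (a b c d : Y) :
  `|c - d| <= `|a - b| + `|(a - c) - (b - d)|.
Proof.
have -> : c - d = (a - b) - ((a - c) - (b - d)).
  by rewrite opprB opprB addrA subrKA addrC subrKA.
exact: ler_normB.
Qed.

Lemma ler_dist_perturb_sym (R : realType) (Y : normedModType R) (a b c d : Y) :
  `|c - d| <= `|a - b| + `|(c - a) - (d - b)|.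
Proof.
have -> : c - d = (a - b) + ((c - a) - (d - b)).
  by rewrite addrACA -opprD [a + _]addrC subrK [b + _]addrC subrK.
exact: ler_normD.
Qed.

Lemma ler_dist_chain (R : realType) (Y : normedModType R) (a b a' b' c d : Y) :
  `|(a' - c) - (b' - d)| <= `|(a - c) - (b - d)| + `|(a' - a) - (b' - b)|.
Proof.
have -> : (a' - c) - (b' - d) = ((a - c) - (b - d)) + ((a' - a) - (b' - b)).
  by rewrite addrACA -opprD [a - c + _]addrC subrKA [b - d + _]addrC subrKA.
exact: ler_normD.
Qed.

(** * Iteration of the perturbation *)

Section attaining.
Context (R : realType) (N : metricType R) (Y : completeNormedModType R).
Hypotheses (cN : seq_complete N) (nN : null_fragments N).

Record stage := Stage {
  st_map : N -> Y; st_p : N; st_q : N; st_mu : R; st_eps : R; st_delta : R }.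

Implicit Types S : stage.

(* [4 * st_eps] leaves room for all later perturbations, of total size at most
   [2 * st_eps]. *)
Definition stage_ok S : Prop :=
  [/\ 0 < st_eps S, 0 < st_delta S <= 8^-1 /\ st_p S <> st_q S,
      `|st_map S (st_p S) - st_map S (st_q S)| +
        4 * st_eps S * mdist (st_p S) (st_q S) <=
        st_mu S * mdist (st_p S) (st_q S),
      forall x y, `|st_map S x - st_map S y| < st_mu S * mdist x y ->
        close_pair (st_delta S) (st_p S) (st_q S) x y &
      forall x y, 4 * st_eps S * mdist x y <= `|st_map S x - st_map S y|].

Lemma make_stage (f : N -> Y) (z : N) (eps delta : R) :
  has_two_points N -> 0 < eps -> 0 < delta <= 8^-1 ->
  (forall x y, 4 * eps * mdist x y <= `|f x - f y|) ->
  exists S, stage_ok S /\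
    [/\ st_map S z = f z,
        forall x y, `|(st_map S x - f x) - (st_map S y - f y)| <=
          eps * mdist x y,
        st_eps S <= eps / 2, st_delta S = delta &
        forall x y, st_mu S * mdist x y <= `|f x - f y|].
Proof.
move=> [x0 [y0 xy0]] eps0 /andP[delta0 delta1] f_ge.
have d_gt0 (x y : N) : x <> y -> 0 < mdist x y by move=> xy; rewrite mdist_gt0; exact/eqP.
have hs : has_inf (slopes f).
  split; first by exists (slope f x0 y0), x0, y0.
  by exists 0 => _ [x [y [_ ->]]]; rewrite divr_ge0 ?mdist_ge0.
pose m := min_modulus f.
have m_le x y : m * mdist x y <= `|f x - f y|.
  have [->|/eqP xy] := eqVneq x y; first by rewrite mdistxx mulr0.
  rewrite -ler_pdivlMr ?d_gt0//; apply: ge_inf; first by case: hs.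
  by exists x, y.
have m_ge : 4 * eps <= m.
  apply: lb_le_inf; first by case: hs.
  by move=> _ [x [y [xy ->]]]; rewrite ler_pdivlMr ?d_gt0.
have [] := @perturbation R N Y f m eps delta m_le _ _ delta0 _ z cN nN.
- exact: eps0.
- by lra.
- by lra.
- have ed0 : 0 < eps * (delta / 4) by rewrite mulr_gt0// divr_gt0.
  have [_ [x [y [xy ->]]]] := inf_adherent ed0 hs.
  by rewrite ltr_pdivrMr ?d_gt0// => h; exists x, y.
move=> g [p [q [mu [gz gf mum [pq gpq] gnear]]]].
have dpq := d_gt0 _ _ pq.
(* With this value, [4 * gap * mdist p q] is the whole margin by which the pair lies below [mu]. *)
pose gap := (mu * mdist p q - `|g p - g q|) / (4 * mdist p q).
have gap0 : 0 < gap by rewrite divr_gt0 ?subr_gt0// mulr_gt0.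
exists (Stage g p q mu (Num.min (eps / 2) gap) delta); split.
  split => /=.
  - by rewrite lt_min gap0 divr_gt0.
  - by rewrite delta0 delta1.
  - have : Num.min (eps / 2) gap * (4 * mdist p q) <= gap * (4 * mdist p q).
      by rewrite ler_pM2r ?mulr_gt0// ge_min lexx orbT.
    by rewrite /gap mulfVK ?gt_eqF ?mulr_gt0//; lra.
  - exact: gnear.
  (* The perturbation uses up [eps] of the lower bound [4 * eps]; the new bound asks for at most
     [2 * eps]. *)
  - move=> x y; have h1 : Num.min (eps / 2) gap * mdist x y <= eps / 2 * mdist x y.
      by rewrite ler_wpM2r ?mdist_ge0// ge_min lexx.
    have h2 := f_ge x y; have h3 := gf x y.
    have h4 := ler_dist_perturb (g x) (g y) (f x) (f y).
    have := mdist_ge0 x y; nra.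
split => //=.
- by rewrite ge_min lexx.
- move=> x y; apply: le_trans (m_le x y); rewrite ler_wpM2r ?mdist_ge0//; exact: ltW.
Qed.

(** The new pair has slope below [st_mu S'] for the new map, and the old map differs by at most
    [st_eps S] in slope; this is still below [st_mu S], so the new pair is close to the old one. *)
Lemma next_stage S (z : N) : stage_ok S -> exists S', stage_ok S' /\
  [/\ st_map S' z = st_map S z /\ st_eps S' <= st_eps S / 2,
      forall x y, `|(st_map S' x - st_map S x) - (st_map S' y - st_map S y)| <=
        st_eps S * mdist x y,
      st_delta S' = st_delta S / 4,
      forall x y, st_mu S' * mdist x y <= `|st_map S x - st_map S y| &
      mdist (st_p S) (st_p S') + mdist (st_q S) (st_q S') <=
        st_delta S * mdist (st_p S) (st_q S)].
Proof.
case: S => g p q mu eps delta [/= eps0 [/andP[delta0 delta1] pq] gpq gnear g_ge].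
have two : has_two_points N by exists p, q.
have [|[g' p' q' mu' eps' delta'] [ok' [/= g'z g'g eps'2 delta'E mu'_le]]] :=
  make_stage z two eps0 (delta := delta / 4) _ g_ge.
  by apply/andP; split; lra.
have [/= eps'0 [delta'0 pq'] gpq' gnear' g'_ge] := ok'.
have d_gt0 (x y : N) : x <> y -> 0 < mdist x y by move=> xy; rewrite mdist_gt0; exact/eqP.
(* [mu'] bounds all slopes of [g] from below, in particular the one at [(p, q)]. *)
have mu_le : mu' <= mu - 4 * eps.
  have := mu'_le p q; have dpq := d_gt0 _ _ pq => h.
  by rewrite -(ler_pM2r dpq); lra.
have near' : close_pair delta p q p' q'.
  apply: gnear; have := g'g p' q'; have dpq' := d_gt0 _ _ pq'.
  have h := ler_dist_perturb (g' p') (g' q') (g p') (g q').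
  have : mu' * mdist p' q' <= (mu - 4 * eps) * mdist p' q' by rewrite ler_pM2r.
  have : 0 < eps' * mdist p' q' by rewrite mulr_gt0.
  have : 0 < eps * mdist p' q' by rewrite mulr_gt0.
  by lra.
case: near' => [near'|near'].
  exists (Stage g' p' q' mu' eps' delta'); split => //; split => //=.
  by rewrite (metric_sym p) (metric_sym q).
(* The new pair is close in the reversed order, so its points are exchanged; then both sequences of
   points converge. *)
exists (Stage g' q' p' mu' eps' delta'); split.
  split => //=.
  - by split => //; apply/nesym.
  - by rewrite distrC (metric_sym q').
  - move=> x y /gnear'; rewrite /close_pair (metric_sym q').
    by move=> []; [right|left].
split => //=.
by rewrite (metric_sym p) (metric_sym q) addrC.
Qed.

Lemma attaining_perturbation (f : N -> Y) (z : N) (L b e : R) :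
  has_two_points N -> 0 < b -> 0 < e ->
  (forall x y, b * mdist x y <= `|f x - f y|) ->
  (forall x y, `|f x - f y| <= L * mdist x y) ->
  exists (g : N -> Y) p q,
    [/\ g z = f z,
        forall x y, `|(g x - f x) - (g y - f y)| <= e * mdist x y,
        p <> q &
        forall x y, `|g p - g q| * mdist x y <= `|g x - g y| * mdist p q].
Proof.
move=> two b0 e0 f_ge f_le.
(* [e / 4] leaves room for the first perturbation and all later ones; [b / 4] gives the lower bound
   that [make_stage] asks for. *)
pose eps0 := Num.min (e / 4) (b / 4).
have eps0_gt0 : 0 < eps0 by rewrite lt_min !divr_gt0.
have [||S0 [ok0 [g0z g0f e0S d0S _]]] :=
    make_stage (f := f) z two eps0_gt0 (delta := 8^-1).
- by apply/andP; split => //; rewrite invr_gt0.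
- move=> x y; apply: le_trans (f_ge x y); rewrite ler_wpM2r ?mdist_ge0//.
  have : eps0 <= b / 4 by rewrite ge_min lexx orbT.
  by lra.
have [nx nxP] := choice (fun S => match pselect (stage_ok S) with
  | left h => let: ex_intro S' hS := next_stage z h in
              ex_intro (fun S' => stage_ok S -> _) S' (fun _ => hS)
  | right h => ex_intro _ S (fun h' => False_ind _ (h h'))
  end).
pose S n := iter n nx S0.
have ok n : stage_ok (S n) by elim: n => //= n /nxP[].
have SP n := (nxP _ (ok n)).2; rewrite -/(S _.+1) in SP.
pose g n := st_map (S n); pose p n := st_p (S n); pose q n := st_q (S n).
pose mu n := st_mu (S n); pose eps n := st_eps (S n).
pose r n := st_delta (S n) * mdist (p n) (q n).
have eps_ge0 n : 0 <= eps n by have [/ltW] := ok n.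
have epsS n : eps n.+1 <= eps n / 2 by have [[_ ?] _ _ _ _] := SP n.
have gz n : g n z = f z.
  by elim: n => // n ih; have [[h _] _ _ _ _] := SP n; rewrite /g h.
have gS n x y : `|(g n.+1 x - g n x) - (g n.+1 y - g n y)| <= eps n * mdist x y.
  by have [_ h _ _ _] := SP n; exact: h.
have delta_bd n : 0 < st_delta (S n) <= 8^-1 by have [_ []] := ok n.
have r_ge0 n : 0 <= r n.
  by have /andP[/ltW ? _] := delta_bd n; rewrite mulr_ge0 ?mdist_ge0.
have pqS n : mdist (p n) (p n.+1) + mdist (q n) (q n.+1) <= r n.
  by have [_ _ _ _ h] := SP n.
(* The closeness parameter is divided by 4, while the distance within the pair at most doubles. *)
have rS n : r n.+1 <= r n / 2.
  have [_ _ hd _ _] := SP n; rewrite /r hd -/(p n) -/(q n).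
  have h := pqS n; rewrite /r -/(p n) -/(q n) in h.
  have /andP[d0 d1] := delta_bd n; set d := st_delta _ in d0 d1 h *.
  have : mdist (p n.+1) (q n.+1) <= 2 * mdist (p n) (q n).
    have := metric_triangle (p n.+1) (p n) (q n.+1).
    have := metric_triangle (p n) (q n) (q n.+1).
    rewrite (metric_sym (p n.+1) (p n)).
    have : d * mdist (p n) (q n) <= 8^-1 * mdist (p n) (q n).
      by rewrite ler_wpM2r ?mdist_ge0.
    have := mdist_ge0 (p n) (q n); lra.
  by rewrite -(ler_pM2l d0); lra.
have pS n : mdist (p n) (p n.+1) <= r n.
  by apply: le_trans (pqS n); rewrite lerDl mdist_ge0.
have qS n : mdist (q n) (q n.+1) <= r n.
  by apply: le_trans (pqS n); rewrite lerDr mdist_ge0.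
have [p_ pl] := metric_halving_cvg cN r_ge0 rS pS.
have [q_ ql] := metric_halving_cvg cN r_ge0 rS qS.
have gcv x : exists l, forall n, `|g n x - l| <= 2 * (eps n * mdist x z).
  apply: norm_halving_cvg => n.
  - by rewrite mulr_ge0 ?mdist_ge0.
  - by rewrite mulrAC ler_wpM2r ?mdist_ge0.
  - by have := gS n x z; rewrite !gz subrr subr0 distrC.
have [G GP] := choice gcv.
have Gz : G z = f z.
  apply/eqP; rewrite eq_sym -subr_eq0 -normr_le0 -(gz 0%N).
  by have := GP z 0%N; rewrite mdistxx !mulr0.
have GS n x y : `|(G x - g n x) - (G y - g n y)| <= 2 * eps n * mdist x y.
  apply/ler_addgt0Pr => t t0.
  have c0 : 0 <= 2 * (mdist x z + mdist y z) by rewrite mulr_ge0 ?addr_ge0 ?mdist_ge0.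
  have [k nk hk] := halving_small eps_ge0 epsS n c0 t0.
  have : `|(g k x - g n x) - (g k y - g n y)| <=
      2 * (eps n * mdist x y) - 2 * (eps k * mdist x y).
    apply: (halving_sum (r := fun n => eps n * mdist x y)
      (D := fun i j => `|(g j x - g i x) - (g j y - g i y)|)) nk.
    - by move=> i; rewrite mulr_ge0 ?mdist_ge0.
    - by move=> i; rewrite mulrAC ler_wpM2r ?mdist_ge0.
    - by move=> i; rewrite !subrr normr0.
    - move=> i j; apply: le_trans (lerD (lexx _) (gS j x y)).
      exact: ler_dist_chain.
  have := ler_dist_chain (g k x) (g k y) (G x) (G y) (g n x) (g n y).
  have := ler_normB (G x - g k x) (G y - g k y).
  have := GP x k; have := GP y k; rewrite (distrC (g k x)) (distrC (g k y)).
  have : 0 <= eps k * mdist x y by rewrite mulr_ge0 ?mdist_ge0.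
  lra.
have Gf x y : `|(G x - f x) - (G y - f y)| <= e * mdist x y.
  have := ler_dist_chain (g 0%N x) (g 0%N y) (G x) (G y) (f x) (f y).
  have := GS 0%N x y; have := g0f x y.
  have e04 : eps0 <= e / 4 by rewrite ge_min lexx.
  have : eps0 * mdist x y <= e / 4 * mdist x y by rewrite ler_wpM2r ?mdist_ge0.
  have : eps 0%N * mdist x y <= eps0 / 2 * mdist x y by rewrite ler_wpM2r ?mdist_ge0.
  have : 0 <= e * mdist x y by rewrite mulr_ge0 ?mdist_ge0 ?ltW.
  by rewrite /g /=; lra.
pose K := `|L| + e.
have GL x y : `|G x - G y| <= K * mdist x y.
  have := ler_dist_perturb_sym (f x) (f y) (G x) (G y).
  have := f_le x y; have := Gf x y.
  have : L * mdist x y <= `|L| * mdist x y by rewrite ler_wpM2r ?mdist_ge0 ?ler_norm.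
  by rewrite /K; lra.
(* The slopes of [G] and [g n] differ by at most [2 * eps n]. So [G] has slope at most [nu n] at the
   [n]-th pair, and a pair at which it has slope below [nu n] is close to the [n]-th one. *)
pose nu n := mu n - 2 * eps n.
have dpq n : 0 < mdist (p n) (q n).
  by have [_ [_ h] _ _ _] := ok n; rewrite mdist_gt0; exact/eqP.
have Gpq n : `|G (p n) - G (q n)| <= nu n * mdist (p n) (q n).
  have [_ _ h _ _] := ok n; have := GS n (p n) (q n).
  have := ler_dist_perturb_sym (g n (p n)) (g n (q n)) (G (p n)) (G (q n)).
  by move: h; rewrite -/(p n) -/(q n) -/(g n) -/(mu n) -/(eps n) /nu; lra.
have nuS n : nu n.+1 <= nu n.
  have [_ _ h _ _] := ok n; have [_ _ _ h' _] := SP n; have := h' (p n) (q n).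
  move: h; rewrite -/(p n) -/(q n) -/(g n) -/(mu n) -/(eps n) -/(mu n.+1) => h h2.
  have : mu n.+1 <= mu n - 4 * eps n by rewrite -(ler_pM2r (dpq n)); lra.
  by rewrite /nu; have := eps_ge0 n; have := eps_ge0 n.+1; lra.
have nu_le n k : (n <= k)%N -> nu k <= nu n.
  move=> nk; elim: k nk => [|k ih]; first by rewrite leqn0 => /eqP ->.
  rewrite leq_eqVlt => /predU1P[<- //|]; rewrite ltnS => /ih.
  exact: le_trans (nuS k).
have K0 : 0 <= K by rewrite addr_ge0// ltW.
have Glim n : `|G p_ - G q_| <= nu n * mdist p_ q_.
  apply/ler_addgt0Pr => t t0.
  have c0 : 0 <= 4 * (`|nu n| + K) by rewrite mulr_ge0// addr_ge0.
  have [k nk hk] := halving_small r_ge0 rS n c0 t0.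
  have h1 : `|G p_ - G q_| <= `|G p_ - G (p k)| + `|G (p k) - G (q k)| +
      `|G (q k) - G q_|.
    by rewrite (le_trans (ler_distD (G (q k)) _ _))// lerD2r ler_distD.
  have h2 : `|G p_ - G (p k)| <= K * (2 * r k).
    by rewrite distrC (le_trans (GL _ _))// ler_wpM2l.
  have h3 : `|G (q k) - G q_| <= K * (2 * r k).
    by rewrite (le_trans (GL _ _))// ler_wpM2l.
  have h4 : nu k * mdist (p k) (q k) <= nu n * mdist (p k) (q k).
    by rewrite ler_wpM2r ?mdist_ge0// nu_le.
  have h5 : nu n * (mdist (p k) (q k) - mdist p_ q_) <= `|nu n| * (4 * r k).
    apply: le_trans (ler_norm _) _; rewrite normrM ler_wpM2l//.
    have := metric_triangle (p k) p_ (q k); have := metric_triangle p_ q_ (q k).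
    have := metric_triangle p_ (p k) q_; have := metric_triangle (p k) (q k) q_.
    have := pl k; have := ql k; rewrite (metric_sym p_ (p k)) (metric_sym q_ (q k)).
    by move=> *; rewrite ler_norml; apply/andP; split; lra.
  by have := Gpq k; lra.
(* Each end moves by at most [2 * r 0], a quarter of the initial distance, so the limit points
   cannot meet. *)
have pq_ : p_ <> q_.
  move=> pq; have := pl 0%N; have := ql 0%N; rewrite -pq.
  have := metric_triangle (p 0%N) p_ (q 0%N); rewrite (metric_sym p_ (q 0%N)).
  have : r 0%N = 8^-1 * mdist (p 0%N) (q 0%N) by rewrite /r /= d0S.
  by have := dpq 0%N; lra.
exists G, p_, q_; split => // x y.
(* If the slope at [(x, y)] is at least some [nu n], then [Glim] settles the comparison. Otherwise
   [(x, y)] is close to the pairs of all stages, hence is the limit pair up to order. *)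
have [far|near] := pselect (exists n, nu n * mdist x y <= `|G x - G y|).
  have [n hn] := far; have D0 := mdist_ge0 p_ q_.
  apply: (@le_trans _ _ (nu n * mdist p_ q_ * mdist x y)).
    by rewrite ler_wpM2r ?mdist_ge0.
  by rewrite mulrAC ler_wpM2r.
(* One [r n] for the closeness to the [n]-th pair and [2 * r n] for each end of that pair to reach
   its limit. *)
have xy_close n : mdist x p_ + mdist y q_ <= 5 * r n \/
    mdist x q_ + mdist y p_ <= 5 * r n.
  have [_ _ _ h _] := ok n.
  have : close_pair (st_delta (S n)) (p n) (q n) x y.
    apply: h; have hn : `|G x - G y| < nu n * mdist x y.
      by rewrite ltNge; apply/negP => ?; apply: near; exists n.
    have := ler_dist_perturb (G x) (G y) (g n x) (g n y); have := GS n x y.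
    by rewrite -/(g n) -/(mu n); move: hn; rewrite /nu; lra.
  rewrite /close_pair -/(r n); have := pl n; have := ql n.
  have := metric_triangle x (p n) p_; have := metric_triangle y (q n) q_.
  have := metric_triangle x (q n) q_; have := metric_triangle y (p n) p_.
  by move=> ? ? ? ? ? ? [?|?]; [left|right]; lra.
have [[-> ->]|npq] := pselect (x = p_ /\ y = q_); first by [].
have [[-> ->]|nqp] := pselect (x = q_ /\ y = p_).
  by rewrite distrC (metric_sym q_).
have sum_gt0 (u v u' v' : N) : ~ (u = u' /\ v = v') -> 0 < mdist u u' + mdist v v'.
  move=> H; rewrite lt_neqAle addr_ge0 ?mdist_ge0// andbT eq_sym.
  rewrite paddr_eq0 ?mdist_ge0//; apply/negP => /andP[/eqP h1 /eqP h2].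
  by apply: H; split; exact: mdist_positivity.
have t0 : 0 < Num.min (mdist x p_ + mdist y q_) (mdist x q_ + mdist y p_).
  by rewrite lt_min !sum_gt0.
have [//|k _] := halving_small r_ge0 rS 0 (c := 5) _ t0.
rewrite lt_min => /andP[k1 k2]; exfalso.
by case: (xy_close k); rewrite leNgt mulrC ?k1 ?k2.
Qed.

End attaining.

Lemma SMA_dense_of_null_fragments (R : realType) (N : metricType R)
    (Y : completeNormedModType R) (z : N) :
  seq_complete N -> null_fragments N -> has_two_points N -> SMA_dense Y z.
Proof.
move=> cN nN two f [fz [L fL]] e e0.
have e2 : 0 < e / 2 by rewrite divr_gt0.
have d_gt0 (x y : N) : x <> y -> 0 < mdist x y.
  by move=> xy; rewrite mdist_gt0; exact/eqP.
have [g [p [q [gz gf pq gmin]]]] : exists (g : N -> Y) p q,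
    [/\ g z = f z,
        forall x y, `|(g x - f x) - (g y - f y)| <= e / 2 * mdist x y,
        p <> q &
        forall x y, `|g p - g q| * mdist x y <= `|g x - g y| * mdist p q].
  have [[b [b0 fb]]|nob] := pselect (exists b, 0 < b /\
      forall x y, b * mdist x y <= `|f x - f y|).
    exact: (attaining_perturbation cN nN z two b0 e2 fb fL).
  have [p [q fpq]] : exists p q, `|f p - f q| < e / 2 * mdist p q.
    apply: contrapT => H; apply: nob; exists (e / 2); split => // x y.
    by rewrite leNgt; apply/negP => ?; apply: H; exists x, y.
  have dpq : 0 < mdist p q.
    have := le_lt_trans (normr_ge0 _) fpq; rewrite pmulr_rgt0//.
  (* A cutoff equal to 1 at [p] and 0 at [q], with Lipschitz constant [1 / mdist p q]. Subtracting
     its multiple by [f p - f q] identifies the images of [p] and [q], at a Lipschitz cost equal to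
     the slope of [f] there. *)
  pose k x := Num.min (mdist x q) (mdist p q) / mdist p q.
  have kL x y : `|k x - k y| * mdist p q <= mdist x y.
    rewrite /k -mulrBl normrM normfV (gtr0_norm dpq) mulfVK ?gt_eqF//.
    have := metric_triangle x y q; have := metric_triangle y x q.
    have := mdist_ge0 x y.
    rewrite (metric_sym y x) ler_norml; case: (leP (mdist x q) (mdist p q)) => ?;
      case: (leP (mdist y q) (mdist p q)) => ? ? ? ?; apply/andP; split; lra.
  exists (fun x => f x - (k x - k z) *: (f p - f q)), p, q; split.
  - by rewrite subrr scale0r subr0.
  - move=> x y; rewrite ![f _ - _ - f _]addrAC !subrr !add0r.
    rewrite opprK addrC -scalerBl normrZ.
    have -> : k y - k z - (k x - k z) = k y - k x by ring.
    apply: le_trans (ler_wpM2l (normr_ge0 _) (ltW fpq)) _.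
    rewrite mulrCA; apply: ler_wpM2l; first exact: ltW.
    by rewrite (metric_sym x) kL.
  - by move=> pq; move: dpq; rewrite pq mdistxx ltxx.
  - move=> x y; suff -> : f p - (k p - k z) *: (f p - f q) -
      (f q - (k q - k z) *: (f p - f q)) = 0.
      by rewrite normr0 mul0r mulr_ge0 ?mdist_ge0.
    have kp : k p = 1 by rewrite /k minxx divff ?gt_eqF.
    have kq : k q = 0 by rewrite /k mdistxx min_l ?mul0r ?mdist_ge0.
    rewrite kp kq.
    have -> : 1 - k z = (0 - k z) + 1 by rewrite sub0r addrC.
    set t := 0 - k z; rewrite scalerDl scale1r.
    move: (f p) (f q) (t *: _) => b c a.
    by rewrite opprD opprB addrCA [b + _]addrC subrK [- a + _]addrC subrr.
have gmin' x y : x <> y -> slope g p q <= slope g x y.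
  move=> xy; rewrite /slope ler_pdivrMr ?d_gt0// mulrAC ler_pdivlMr ?d_gt0//.
exists g; split.
  split.
    split; first by rewrite gz.
    exists (L + e / 2) => x y.
    have := ler_dist_perturb_sym (f x) (f y) (g x) (g y).
    by have := fL x y; have := gf x y; lra.
  exists p, q; split => //; apply/eqP; rewrite eq_le; apply/andP; split.
    apply: lb_le_inf; first by exists (slope g p q), p, q.
    by move=> _ [x [y [xy ->]]]; exact: gmin'.
  apply: ge_inf; last by exists p, q.
  by exists (slope g p q) => _ [x [y [xy ->]]]; exact: gmin'.
apply: (@le_lt_trans _ _ (e / 2)); last by lra.
apply: sup_le_ub; first by exists (slope (f - g) p q), p, q.
move=> _ [x [y [xy ->]]]; rewrite /slope ler_pdivrMr ?d_gt0//.
have -> : (f - g) x - (f - g) y = (g y - f y) - (g x - f x).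
  transitivity ((f x - g x) - (f y - g y)) => //.
  by rewrite -[f x - g x]opprB -[f y - g y]opprB opprK addrC.
by rewrite metric_sym; exact: gf.
Qed.

(** * Bi-Lipschitz pieces of curves *)

(** This replaces an arbitrary parameter set by a closed, hence measurable, one. *)
Lemma lipschitz_closure_extension (R : realType) (M : metricType R) (A : set R)
    (gamma : R -> M) (L : R) : complete_metric M -> 0 < L ->
  (forall s t, A s -> A t -> mdist (gamma s) (gamma t) <= L * `|s - t|) ->
  exists gamma' : R -> M, (forall t, A t -> gamma' t = gamma t) /\
    forall s t : R, closure A s -> closure A t ->
      mdist (gamma' s) (gamma' t) <= L * `|s - t|.
Proof.
move=> /complete_metric_seq cM L0 gL.
have ext t : exists x, (A t -> x = gamma t) /\ (closure A t ->
    forall e : R, 0 < e -> exists a, [/\ A a, `|t - a| < e & mdist (gamma a) x < e]).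
  have [At|nAt] := pselect (A t).
    by exists (gamma t); split => // _ e e0; exists t; rewrite subrr normr0 mdistxx.
  have [cAt|ncAt] := pselect (closure A t); last by exists (gamma t).
  have near_t n : exists a, A a /\ `|t - a| < n.+1%:R^-1.
    by have [a [Aa ta]] := cAt _ (nbhsx_ballx t n.+1%:R^-1 ltac:(by [])); exists a.
  have [u uP] := choice near_t.
  have small (e : R) : 0 < e -> exists n0, forall n, (n0 <= n)%N -> n.+1%:R^-1 < e.
    by move=> e0; have [n0 _ H] := near_infty_natSinv_lt (PosNum e0); exists n0.
  have [e e0|l ul] := cM (gamma \o u).
    have [n0 H] := small (e / (2 * L)) (divr_gt0 e0 (mulr_gt0 (ltr0Sn R 1) L0)).
    exists n0 => i j ni nj; apply: le_lt_trans (gL _ _ (uP i).1 (uP j).1) _.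
    have := ler_distD t (u i) (u j); rewrite (distrC (u i) t).
    have := (uP i).2; have := (uP j).2; have := H _ ni; have := H _ nj.
    move=> h1 h2 h3 h4 h5; rewrite mulrC -ltr_pdivlMr//.
    have -> : e / L = e / (2 * L) + e / (2 * L) by field; rewrite gt_eqF.
    by apply: le_lt_trans h5 _; apply: ltrD; [apply: lt_trans h2|apply: lt_trans h1].
  exists l; split => // _ e e0; have [n1 H1] := ul e e0; have [n2 H2] := small e e0.
  exists (u (maxn n1 n2)); split; first exact: (uP _).1.
    by apply: lt_trans (uP _).2 _; apply: H2; exact: leq_maxr.
  by apply: H1; exact: leq_maxl.
have [gamma' gP] := choice ext; exists gamma'; split => [t|]; first exact: (gP t).1.
move=> s t cs ct; apply/ler_addgt0Pr => /= e e0.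
have e'0 : 0 < e / (2 * (L + 1)) by rewrite divr_gt0// mulr_gt0// addr_gt0.
have [a [Aa sa ga]] := (gP s).2 cs _ e'0; have [b [Ab tb gb]] := (gP t).2 ct _ e'0.
have -> : e = 2 * (e / (2 * (L + 1))) + L * (2 * (e / (2 * (L + 1)))).
  by field; rewrite gt_eqF// addr_gt0.
move: (e / _) e'0 sa ga tb gb => /= d d0 sa ga tb gb.
have := metric_triangle (gamma' s) (gamma a) (gamma' t).
have := metric_triangle (gamma a) (gamma b) (gamma' t).
rewrite (metric_sym (gamma' s) (gamma a)).
have ab : L * `|a - b| <= L * (`|s - t| + 2 * d).
  rewrite ler_pM2l//; have := ler_distD s a b; have := ler_distD t s b.
  by rewrite (distrC a s); lra.
by have := gL _ _ Aa Ab; lra.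
Qed.

Lemma le_lebesgue (R : realType) (A B : set R) :
  measurable A -> measurable B -> A `<=` B ->
  (lebesgue_measure A <= lebesgue_measure B)%E.
Proof. by move=> mA mB AB; apply: le_measure; rewrite ?inE. Qed.

(** The measure of [A] may be infinite, so outer regularity is applied to the bounded pieces of [A]
    in [[-n, n]], with errors [eta / 2 ^ n.+1]. *)
Lemma open_superset (R : realType) (A : set R) (eta : R) :
  measurable A -> 0 < eta -> exists U : set R,
    [/\ open U, A `<=` U & (lebesgue_measure (U `\` A) <= eta%:E)%E].
Proof.
move=> mA eta0.
have mAn n : measurable (A `&` `[- n%:R, n%:R]%classic : set R).
  by apply: measurableI => //; exact: measurable_itv.
have An n : exists U : set R, [/\ open U, A `&` `[- n%:R, n%:R]%classic `<=` U &
    (lebesgue_measure (U `\` (A `&` `[(- n%:R)%R, n%:R%R]%classic)) <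
      (eta / (2 ^ n.+1)%:R)%:E)%E].
  apply: lebesgue_regularity_outer => //; last first.
    by rewrite divr_gt0// ltr0n expn_gt0.
  apply: (@le_lt_trans _ _ (lebesgue_measure (`[- n%:R, n%:R]%classic : set R))).
    by apply: le_lebesgue.
  by rewrite lebesgue_measure_itv /=; case: ifP => _; rewrite ?ltry.
have [U UP] := choice An; exists (\bigcup_n U n); split.
- by apply: bigcup_open => n _; have [] := UP n.
- move=> x Ax; have : [set: R] x by [].
  rewrite -(bigcup_itvT true false) => -[n _ nx]; exists n => //.
  by have [_ AU _] := UP n; exact: AU.
- apply: le_trans (epsilon_trick0 xpredT (ltW eta0)).
  have mU n : measurable (U n `\` (A `&` `[- n%:R, n%:R]%classic)).
    by apply: measurableD => //; apply: open_measurable; have [] := UP n.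
  apply: (@le_trans _ _ (\sum_(0 <= n <oo)
      lebesgue_measure (U n `\` (A `&` `[(- n%:R)%R, n%:R%R]%classic)))%E).
    apply: measure_sigma_subadditive => //.
      apply: measurableD => //; apply: bigcupT_measurable => n.
      by apply: open_measurable; have [] := UP n.
    by move=> x [[n _ Ux] nAx]; exists n => //; split => // -[].
  by apply: lee_nneseries => // n _; have [_ _ /ltW] := UP n.
Qed.

Lemma le_diam (R : realType) (M : metricType R) (S : set M) (b : \bar R) :
  (0 <= b)%E -> (forall x y, S x -> S y -> ((mdist x y)%:E <= b)%E) ->
  (diam S <= b)%E.
Proof.
by move=> b0 Sb; apply: ge_ereal_sup => _ [->//|[x Sx [y Sy <-]]]; exact: Sb.
Qed.

Lemma hausdorff1_ge0 (R : realType) (M : metricType R) (E : set M) :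
  (0 <= hausdorff1 E)%E.
Proof.
apply: (@le_trans _ _ (hausdorff1_delta 1 E)); last first.
  by apply: ereal_sup_ubound; exists 1 => //=.
apply: le_ereal_inf_tmp => _ [U _ <-]; apply: nneseries_ge0 => i _ _.
exact: diam_ge0.
Qed.

Lemma hausdorff1_null (R : realType) (M : metricType R) (E : set M) :
  (forall eta : R, 0 < eta -> exists U : (set M)^nat,
    [/\ forall i, (diam (U i) <= eta%:E)%E, E `<=` \bigcup_i U i &
      (\sum_(0 <= i <oo) diam (U i) <= eta%:E)%E]) ->
  hausdorff1 E = 0%E.
Proof.
move=> EU; apply/eqP; rewrite eq_le hausdorff1_ge0 andbT.
apply: ge_ereal_sup => _ [d d0 <-]; apply/lee_addgt0Pr => e e0; rewrite add0e.
have [U [Ud EUc Us]] := EU (Num.min d e) ltac:(by rewrite lt_min d0).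
apply: (@le_trans _ _ (\sum_(0 <= i <oo) diam (U i))%E).
  apply: ereal_inf_lbound; exists U => //; split => // i.
  by apply: le_trans (Ud i) _; rewrite lee_fin ge_min lexx.
by apply: le_trans Us _; rewrite lee_fin ge_min lexx orbT.
Qed.

(* A is covered by the components J of an open set exceeding it by little, and the
   diameter of the image of J is at most L times the measure of J minus A. *)
Lemma hausdorff1_null_of_gaps (R : realType) (M : metricType R) (A : set R)
    (gamma : R -> M) (L : R) : closed A -> 0 < L ->
  (forall s t, A s -> A t -> s <= t -> ((mdist (gamma s) (gamma t))%:E <=
      L%:E * lebesgue_measure (`[s, t]%classic `\` A : set R))%E) ->
  hausdorff1 (gamma @` A) = 0%E.
Proof.
move=> cA L0 gA; apply: hausdorff1_null => eta eta0.
have mA : measurable A by exact: closed_measurable.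
have [V [oV AV Veta]] := open_superset mA (divr_gt0 eta0 L0).
pose J := open_disjoint_itv oV.
have mJ i : measurable (J i `\` A).
  by apply: measurableD => //; apply: open_measurable; exact: open_disjoint_itv_open.
have VJ : V `\` A = \bigcup_i (J i `\` A).
  by rewrite -setD_bigcupl -open_disjoint_itv_bigcup.
have gJ i x y : (gamma @` (A `&` J i)) x -> (gamma @` (A `&` J i)) y ->
    ((mdist x y)%:E <= L%:E * lebesgue_measure (J i `\` A))%E.
  suff gJ s t : s <= t -> (A `&` J i) s -> (A `&` J i) t ->
      ((mdist (gamma s) (gamma t))%:E <= L%:E * lebesgue_measure (J i `\` A))%E.
    move=> [s Js <-] [t Jt <-]; have [st|/ltW ts] := leP s t; first exact: gJ.
    by rewrite metric_sym; exact: gJ.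
  move=> st [As Js] [At Jt]; apply: le_trans (gA _ _ As At st) _.
  rewrite lee_pmul2l//; apply: le_lebesgue => //.
    by apply: measurableD => //; exact: measurable_itv.
  apply: setSD => r /=; rewrite in_itv /= => srt.
  exact: (open_disjoint_itv_is_interval Js Jt).
have dJ i : (diam (gamma @` (A `&` J i)) <=
    L%:E * lebesgue_measure (J i `\` A))%E.
  by apply: le_diam (@gJ i); rewrite mule_ge0// lee_fin ltW.
have LV : (L%:E * lebesgue_measure (V `\` A) <= eta%:E)%E.
  have -> : eta = L * (eta / L) by field; rewrite gt_eqF.
  by rewrite EFinM lee_pmul2l.
exists (fun i => gamma @` (A `&` J i)); split.
- move=> i; apply: le_trans (dJ i) _; apply: le_trans LV; rewrite lee_pmul2l//.
  apply: le_lebesgue => //; last by rewrite VJ => t Jt; exists i.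
  by apply: measurableD => //; exact: open_measurable.
- move=> _ [t At <-]; have := AV _ At; rewrite (open_disjoint_itv_bigcup oV).
  by move=> [i _ Jt]; exists i => //; exists t.
- apply: le_trans LV; rewrite VJ measure_semi_bigcup//; last first.
    exact: bigcupT_measurable.
    apply: trivIset_setIr.
    exact: open_disjoint_itv_trivIset.
  rewrite -nneseriesZl//; apply: lee_nneseries => i _; last exact: dJ.
  by move=> _; exact: diam_ge0.
Qed.

(** * Lipschitz extension and the rising sun lemma *)

Lemma mcshane_extension (R : realType) (A : set R) (h : R -> R) (L : R) :
  0 <= L -> (forall s t, A s -> A t -> `|h s - h t| <= L * `|s - t|) ->
  exists F : R -> R, (forall t, A t -> F t = h t) /\
    forall s t, `|F s - F t| <= L * `|s - t|.
Proof.
move=> L0 hL; have [[s0 As0]|nA] := pselect (exists s, A s); last first.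
  exists (fun=> 0); split=> [t At|s t]; first by case: nA; exists t.
  by rewrite subrr normr0 mulr_ge0.
(* McShane's formula: the extension is the lower envelope of the cones of slope [L] with vertices on
   the graph of [h]. *)
pose S t := [set h s + L * `|s - t| | s in A].
have Slb t : has_inf (S t).
  split; first by exists (h s0 + L * `|s0 - t|), s0.
  exists (h s0 - L * `|s0 - t|) => _ [s As <-].
  have := hL _ _ As0 As; have : L * `|s0 - s| <= L * (`|s0 - t| + `|s - t|).
    by rewrite ler_wpM2l// (distrC s t) ler_distD.
  by rewrite ler_norml => ? /andP[]; lra.
have FL s t : inf (S s) - inf (S t) <= L * `|s - t|.
  rewrite lerBlDr -lerBlDl; apply: lb_le_inf; first exact: (Slb t).1.
  move=> _ [r Ar <-]; rewrite lerBlDl.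
  apply: (@le_trans _ _ (h r + L * `|r - s|)).
    by apply: ge_inf; [exact: (Slb s).2|exists r].
  rewrite addrCA lerD2l -mulrDr ler_wpM2l// [leRHS]addrC (distrC s t).
  exact: ler_distD.
exists (fun t => inf (S t)); split=> [t At|s t]; last first.
  by rewrite ler_norml FL andbT lerNl opprB distrC FL.
apply/eqP; rewrite eq_le; apply/andP; split.
  apply: ge_inf; first exact: (Slb t).2.
  by exists t => //; rewrite subrr normr0 mulr0 addr0.
apply: lb_le_inf; first exact: (Slb t).1.
move=> _ [s As <-]; have := hL _ _ At As; rewrite (distrC t s) ler_norml.
by move=> /andP[_]; lra.
Qed.

(* The shade of the rising sun lemma is the complement of this set. *)
Definition record_points (R : realType) (psi : R -> R) (a b : R) : set R :=
  [set t | a <= t <= b /\ forall s, a <= s <= t -> psi s <= psi t].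

Section record_points.
Context (R : realType) (psi : R -> R) (a b K : R).
Hypothesis K_gt0 : 0 < K.
Hypothesis psiK : forall s t, `|psi s - psi t| <= K * `|s - t|.

Let psi_near s t e : `|s - t| < e / K -> psi s < psi t + e.
Proof.
rewrite ltr_pdivlMr// mulrC => st.
by have := le_lt_trans (psiK s t) st; rewrite ltr_norml => /andP[_]; lra.
Qed.

Lemma closed_record_points : closed (record_points psi a b).
Proof.
move=> t ct; split.
  apply: (@interval_closed R (BLeft a) (BRight b)) => //= U tU.
  have [r [[rab _] Ur]] := ct _ tU.
  by exists r; split => //=; rewrite in_itv.
move=> s /andP[as_ st]; have [->//|ns] := eqVneq s t.
have {st ns} st : s < t by rewrite lt_neqAle ns.
apply/ler_addgt0Pr => /= e e0.
have d0 : 0 < Num.min (t - s) (e / K) by rewrite lt_min subr_gt0 st divr_gt0.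
have [r [[_ rec]]] := ct _ (nbhsx_ballx _ _ d0).
rewrite /ball /= lt_min distrC => /andP[r1 r2].
apply: (@le_trans _ _ (psi r)); last by apply/ltW/psi_near.
by apply: rec; rewrite as_; move: r1; rewrite ltr_norml => /andP[]; lra.
Qed.

(** The first time at which [psi] reaches the level [v] is a record point, and by continuity the
    value there is [v]. *)
Lemma record_points_image : a <= b ->
  `[psi a, psi b]%classic `<=` psi @` record_points psi a b.
Proof.
move=> ab v /=; rewrite in_itv /= => /andP[av vb].
pose S := [set t | a <= t <= b /\ v <= psi t].
have Sb : S b by split => //; rewrite ab lexx.
have hS : has_inf S by split; [exists b|exists a => t [/andP[]]].
have aS : a <= inf S by apply: lb_le_inf; [exists b|move=> t [/andP[]]].
have Sinf s : a <= s -> s < inf S -> psi s < v.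
  move=> as_ sS; rewrite ltNge; apply/negP => vs.
  have : inf S <= s; last by rewrite leNgt sS.
  apply: ge_inf; first exact: hS.2.
  by split => //; rewrite as_ (le_trans (ltW sS))//; apply: ge_inf hS.2 _ Sb.
have vS : v <= psi (inf S).
  apply/ler_addgt0Pr => /= e e0; have eK : 0 < e / K by rewrite divr_gt0.
  have [t St tS] := inf_adherent eK hS.
  apply: (@le_trans _ _ (psi t)); first by case: St.
  apply/ltW/psi_near; rewrite ger0_norm; first by rewrite ltrBlDl.
  by rewrite subr_ge0; apply: ge_inf hS.2 _ St.
have Sv : psi (inf S) <= v.
  move: aS; rewrite le_eqVlt => /orP[/eqP <-//|aS].
  apply/ler_addgt0Pr => /= e e0; have eK : 0 < e / K by rewrite divr_gt0.
  pose s := Num.max a (inf S - e / K / 2).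
  have sS : s < inf S by rewrite gt_max aS/= ltrBlDr ltrDl divr_gt0.
  apply: (@le_trans _ _ (psi s + e)); last first.
    by rewrite lerD2r ltW// Sinf// le_max lexx.
  apply/ltW/psi_near; rewrite gtr0_norm ?subr_gt0//.
  have : inf S - e / K / 2 <= s by rewrite le_max lexx orbT.
  by move: (e / K) eK => x x0; lra.
exists (inf S); last by apply/eqP; rewrite eq_le Sv.
split; first by rewrite aS /=; apply: ge_inf hS.2 _ Sb.
move=> s /andP[as_]; rewrite le_eqVlt => /orP[/eqP->//|sS].
exact: le_trans (ltW (Sinf _ as_ sS)) vS.
Qed.

End record_points.

Lemma interval_diam_le (R : realType) (J : set R) : open J -> is_interval J ->
  (diam (J : set R^o) <= lebesgue_measure J)%E.
Proof.
move=> oJ iJ; apply: le_diam => // x y.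
suff le s t : s <= t -> J s -> J t -> ((mdist (s : R^o) t)%:E <= lebesgue_measure J)%E.
  move=> Jx Jy; have [xy|/ltW yx] := leP x y; first exact: le.
  by rewrite metric_sym; exact: le.
move=> st Js Jt; rewrite /mdist /= ger0_norm ?subr_ge0//.
apply: (@le_trans _ _ (lebesgue_measure (`[s, t]%classic : set R))).
  rewrite lebesgue_measure_itv /= lte_fin; case: ltP => // ts.
  by rewrite lee_fin subr_le0.
apply: le_lebesgue; [exact: measurable_itv|exact: open_measurable|].
by move=> r /=; rewrite in_itv /= => srt; exact: (iJ s t).
Qed.

(** The components of an open set slightly larger than [S] form a cover whose diameters sum to at
    most its measure. *)
Lemma lipschitz_image_measure (R : realType) (S : set R) (psi : R -> R)
    (K G eta : R) : measurable S -> (lebesgue_measure S <= G%:E)%E ->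
  0 < K -> (forall s t, `|psi s - psi t| <= K * `|s - t|) -> 0 < eta ->
  exists Y : set R, [/\ measurable Y,
    (lebesgue_measure Y <= (2 * K * (G + eta))%:E)%E & psi @` S `<=` Y].
Proof.
move=> mS SG K0 psiK eta0; have [U [oU SU Ueta]] := open_superset mS eta0.
have mU := open_measurable oU.
have mJ i : measurable (open_disjoint_itv oU i).
  by apply: open_measurable; exact: open_disjoint_itv_open.
apply: (@lipschitz_image_cover R R^o S (open_disjoint_itv oU)) => //.
- by apply: subset_trans SU _; rewrite -open_disjoint_itv_bigcup.
- apply: (@le_trans _ _ (lebesgue_measure U)).
    rewrite [in leRHS](open_disjoint_itv_bigcup oU) measure_semi_bigcup//.
    + apply: lee_nneseries => i _; first by move=> _; exact: diam_ge0.
      apply: interval_diam_le; first exact: open_disjoint_itv_open.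
      exact: open_disjoint_itv_is_interval.
    + exact: open_disjoint_itv_trivIset.
    + exact: bigcupT_measurable.
  rewrite -(setDUK SU) measureU//; last by rewrite setDE setICA setICr setI0.
    by rewrite EFinD leeD.
  exact: measurableD.
- by move=> x y _ _; rewrite metric_sym; exact: psiK.
Qed.

(** At record points of [psi t = phi t - c * t] the distance to [gamma a] grows at rate at least
    [c], which bounds [gamma] from below on [E]. If [E] were null, [psi] would map a null set and
    the gaps of [A] onto [[psi a, psi b]], which is too long for that. *)
Lemma bilipschitz_piece (R : realType) (M : metricType R) (A : set R)
    (gamma : R -> M) (L a b : R) : closed A -> 0 < L ->
  (forall s t, A s -> A t -> mdist (gamma s) (gamma t) <= L * `|s - t|) ->
  A a -> A b -> a <= b ->
  ((2 * L)%:E * lebesgue_measure (`[a, b]%classic `\` A : set R) <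
    (mdist (gamma a) (gamma b))%:E)%E ->
  exists (E : set R) (c : R), [/\ compact E, E `<=` A, 0 < c,
    (0 < lebesgue_measure E)%E &
    forall s t, E s -> E t -> c * `|s - t| <= mdist (gamma s) (gamma t)].
Proof.
move=> cA L0 gL Aa Ab ab.
have mA : measurable A by exact: closed_measurable.
have mB : measurable (`[a, b]%classic `\` A : set R).
  by apply: measurableD => //; exact: measurable_itv.
have Bfin : (lebesgue_measure (`[a, b]%classic `\` A : set R) < +oo)%E.
  apply: (@le_lt_trans _ _ (lebesgue_measure (`[a, b]%classic : set R))).
    by apply: le_lebesgue => //.
  by rewrite lebesgue_measure_itv /=; case: ifP => _; rewrite -?EFinD ltry.
pose G := fine (lebesgue_measure (`[a, b]%classic `\` A : set R)).
have BG : lebesgue_measure (`[a, b]%classic `\` A : set R) = G%:E.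
  by rewrite fineK// ge0_fin_numE.
have G0 : 0 <= G by exact: fine_ge0.
rewrite BG -EFinM lte_fin; set D := mdist _ _ => GD.
have {ab} ab : a < b.
  rewrite lt_neqAle ab andbT; apply/eqP => eab; move: GD.
  rewrite /D eab mdistxx ltNge mulr_ge0//.
  by rewrite mulr_ge0// ltW.
have [phi [phiA phiL]] : exists F : R -> R,
    (forall t, A t -> F t = mdist (gamma a) (gamma t)) /\
    forall s t, `|F s - F t| <= L * `|s - t|.
  apply: mcshane_extension; first exact: ltW.
  move=> s t As At; apply: le_trans (gL _ _ As At).
  have := metric_triangle (gamma a) (gamma s) (gamma t).
  have := metric_triangle (gamma a) (gamma t) (gamma s).
  rewrite (metric_sym (gamma t) (gamma s)) ler_norml => ? ?.
  by apply/andP; split; lra.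
(* The length [D - c * (b - a)] of [[psi a, psi b]] must exceed the bound [2 * (L + c) * G] for the
   image of the gaps; this [c] consumes half of the available excess. *)
pose c := (D - 2 * L * G) / (2 * (b - a + 2 * G)).
have c0 : 0 < c by rewrite divr_gt0; lra.
have Dc : D = 2 * L * G + 2 * c * (b - a + 2 * G).
  by rewrite /c; field; rewrite gt_eqF; lra.
pose psi t := phi t - c * t.
have K0 : 0 < L + c by rewrite addr_gt0.
have psiK s t : `|psi s - psi t| <= (L + c) * `|s - t|.
  have -> : psi s - psi t = (phi s - phi t) - c * (s - t) by rewrite /psi; ring.
  by rewrite mulrDl (le_trans (ler_normB _ _))// lerD// normrM gtr0_norm.
pose T := record_points psi a b; pose E := T `&` A.
have cT : closed T by exact: closed_record_points K0 psiK.
have cE : compact E.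
  apply: (@subclosed_compact _ _ `[a, b]%classic); first exact: closedI.
    exact: segment_compact.
  by move=> t [[tab _] _]; rewrite /= in_itv.
exists E, c; split => //; first exact: subIsetr.
- rewrite lt_neqAle measure_ge0 andbT; apply/eqP => /esym E0.
  have cG : 0 <= c * G by rewrite mulr_ge0// ltW.
  have cba : 0 < c * (b - a) by rewrite mulr_gt0// subr_gt0.
  (* The two images together lose [4 * (L + c) * eta], half of the remaining excess. *)
  pose eta := (c * (b - a) + 2 * c * G) / (8 * (L + c)).
  have eta0 : 0 < eta.
    by rewrite divr_gt0 ?mulr_gt0//; lra.
  have etaE : c * (b - a) + 2 * c * G = 8 * (L + c) * eta.
    by rewrite /eta; field; rewrite gt_eqF.
  have mE : measurable E by exact: compact_measurable.
  have E00 : (lebesgue_measure E <= 0%:E)%E by rewrite E0.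
  have BG' : (lebesgue_measure (`[a, b]%classic `\` A : set R) <= G%:E)%E.
    by rewrite BG.
  have [Y1 [mY1 lY1 EY1]] := lipschitz_image_measure mE E00 K0 psiK eta0.
  have [Y2 [mY2 lY2 EY2]] := lipschitz_image_measure mB BG' K0 psiK eta0.
  have psiab : psi b - psi a = D - c * (b - a).
    by rewrite /psi !phiA// mdistxx -/D; ring.
  have LG : 0 <= L * G by rewrite mulr_ge0// ltW.
  have : (lebesgue_measure (`[psi a, psi b]%classic : set R) <=
      lebesgue_measure Y1 + lebesgue_measure Y2)%E.
    apply: (@le_trans _ _ (lebesgue_measure (Y1 `|` Y2))); last exact: measureU2.
    apply: le_lebesgue; [exact: measurable_itv|exact: measurableU|].
    move=> v /(record_points_image K0 psiK (ltW ab)) [t Tt <-].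
    have [At|nAt] := pselect (A t); [left; apply: EY1|right; apply: EY2]; exists t => //.
    by case: Tt; rewrite /= in_itv.
  have lt_ab : psi a < psi b by rewrite -subr_gt0 psiab; lra.
  rewrite lebesgue_measure_itv /= lte_fin lt_ab -EFinB psiab.
  move=> /le_trans/(_ (leeD lY1 lY2)); rewrite -EFinD lee_fin.
  have : 0 < (L + c) * eta by rewrite mulr_gt0.
  lra.
- suff le s t : s <= t -> E s -> E t -> c * (t - s) <= mdist (gamma s) (gamma t).
    move=> s t Es Et; have [st|/ltW ts] := leP s t.
      by rewrite distrC ger0_norm ?subr_ge0//; exact: le.
    by rewrite ger0_norm ?subr_ge0// metric_sym; exact: le.
  move=> st [[/andP[as_ _] _] As] [[_ rec] At].
  have := rec s; rewrite as_ st /psi !phiA// => /(_ isT).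
  by have := metric_triangle (gamma a) (gamma s) (gamma t); lra.
Qed.

(** * Intertwined sets and density *)

Lemma lebesgue_gt0 (R : realType) (A : set R) : measurable A ->
  (0 < lebesgue_measure A)%E <-> ~ (@lebesgue_measure R).-negligible A.
Proof.
move=> mA; rewrite lt_neqAle measure_ge0 andbT negligibleP//.
by split => [/eqP A0 /esym//|A0]; apply/eqP => /esym.
Qed.

Definition nth_rat (R : realType) (n : nat) : R :=
  if unpickle n is Some q then ratr (q : rat) else 0.

Lemma nth_rat_dense (R : realType) (x y : R) : x < y ->
  exists n, x < nth_rat R n < y.
Proof.
move=> /rat_in_itvoo[q]; rewrite in_itv /= => xqy.
by exists (pickle q); rewrite /nth_rat pickleK.
Qed.

(** Countably many windows of length [r] cover the line, so one of them meets [S] in a set that is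
    not null. *)
Lemma small_positive_subset (R : realType) (S : set R) (r : R) :
  measurable S -> (0 < lebesgue_measure S)%E -> 0 < r ->
  exists V : set R, [/\ measurable V, V `<=` S, (0 < lebesgue_measure V)%E &
    (lebesgue_measure V <= r%:E)%E].
Proof.
move=> mS /(lebesgue_gt0 mS) S0 r0.
pose I n : set R := `[nth_rat R n, nth_rat R n + r]%classic.
have mV n : measurable (S `&` I n) by apply: measurableI => //; exact: measurable_itv.
have [n Vn] : exists n, ~ (@lebesgue_measure R).-negligible (S `&` I n).
  apply: contrapT => H; apply: S0.
  apply: (@negligibleS _ _ _ (@lebesgue_measure R) (\bigcup_n (S `&` I n))); last first.
    by apply: negligible_bigcup => n; apply: contrapT => h; apply: H; exists n.
  move=> x Sx; have [n /andP[xn nx]] : exists n, x - r < nth_rat R n < x.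
    by apply: nth_rat_dense; rewrite ltrBlDr ltrDl.
  exists n => //; split => //; rewrite /I /= in_itv /=; apply/andP; split; lra.
exists (S `&` I n); split => //; first exact/lebesgue_gt0.
apply: (@le_trans _ _ (lebesgue_measure (I n))).
  by apply: le_lebesgue => //; exact: measurable_itv.
by rewrite lebesgue_measure_itv /= lte_fin ltrDl r0 -EFinD lee_fin; lra.
Qed.

(** From [E] remove, for each rational interval that it charges, a piece of positive measure inside
    that interval, the pieces having total measure at most half that of [E]. What is left is [A]. *)
Lemma intertwined_subset (R : realType) (E : set R) :
  measurable E -> (0 < lebesgue_measure E)%E -> (lebesgue_measure E < +oo)%E ->
  exists A : set R, [/\ measurable A, A `<=` E, (0 < lebesgue_measure A)%E &
    forall p q, (0 < lebesgue_measure (A `&` `[p, q]%classic))%E ->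
      (0 < lebesgue_measure ((E `\` A) `&` `[p, q]%classic))%E].
Proof.
move=> mE E0 Efin.
pose e := fine (lebesgue_measure E).
have Ee : lebesgue_measure E = e%:E by rewrite fineK// ge0_fin_numE.
have e0 : 0 < e by rewrite -lte_fin -Ee.
pose lo k : R := if @unpickle (nat * nat)%type k is Some u then nth_rat R u.1 else 0.
pose hi k : R := if @unpickle (nat * nat)%type k is Some u then nth_rat R u.2 else 0.
pose S k := E `&` `[lo k, hi k]%classic.
have mS k : measurable (S k) by apply: measurableI => //; exact: measurable_itv.
have SU k : exists U : set R, [/\ measurable U, U `<=` S k,
    (0 < lebesgue_measure (S k) -> 0 < lebesgue_measure U)%E &
    (lebesgue_measure U <= (e / 2 / (2 ^ k.+1)%:R)%:E)%E].
  have r0 : 0 < e / 2 / (2 ^ k.+1)%:R by rewrite !divr_gt0// ltr0n expn_gt0.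
  have [Sk|nSk] := pselect (0 < lebesgue_measure (S k))%E.
    have [V [mV VS V0 Vr]] := small_positive_subset (mS k) Sk r0.
    by exists V.
  by exists set0; split => //; rewrite measure0 lee_fin ltW.
have [U UP] := choice SU.
have mU k : measurable (U k) by case: (UP k).
have mUU : measurable (\bigcup_k U k) by exact: bigcupT_measurable.
exists (E `\` \bigcup_k U k); split.
- exact: measurableD.
- exact: subDsetl.
- have UUe : (lebesgue_measure (\bigcup_k U k) <= (e / 2)%:E)%E.
    apply: le_trans (generalized_Boole_inequality (@lebesgue_measure R) mU mUU) _.
    have e2 : 0 <= e / 2 by rewrite divr_ge0// ltW.
    apply: le_trans (epsilon_trick0 xpredT e2).
    by apply: lee_nneseries => // k _; case: (UP k).
  rewrite lt_neqAle measure_ge0 andbT; apply/eqP => /esym A0.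
  have : (lebesgue_measure E <= lebesgue_measure (E `\` \bigcup_k U k) +
      lebesgue_measure (\bigcup_k U k))%E.
    apply: (@le_trans _ _ (lebesgue_measure
      ((E `\` \bigcup_k U k) `|` \bigcup_k U k))); last first.
      by apply: measureU2 => //; exact: measurableD.
    apply: le_lebesgue => //; first by apply: measurableU => //; exact: measurableD.
    by move=> x Ex; have [Ux|nUx] := pselect ((\bigcup_k U k) x); [right|left].
  by rewrite A0 add0e => /le_trans/(_ UUe); rewrite Ee lee_fin; lra.
- move=> p q; rewrite setDD.
  have mpq : measurable (`[p, q]%classic : set R) by exact: measurable_itv.
  have mA : measurable ((E `\` \bigcup_k U k) `&` `[p, q]%classic).
    by apply: measurableI => //; exact: measurableD.
  move=> /(lebesgue_gt0 mA) A0.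
  have [k [kpq Sk]] : exists k, `[lo k, hi k]%classic `<=` `[p, q]%classic /\
      ~ (@lebesgue_measure R).-negligible (S k).
    (* Apart from [p] and [q], the points of [E] in [[p, q]] lie in rational intervals inside
       [[p, q]]; if [E] were null in all of these, [A] would be null in [[p, q]]. *)
    apply: contrapT => H; apply: A0.
    pose W k := [set x | `[lo k, hi k]%classic `<=` `[p, q]%classic /\ S k x].
    apply: (@negligibleS _ _ _ (@lebesgue_measure R)
      (\bigcup_k W k `|` ([set p] `|` [set q]))); last first.
      apply: negligibleU; last first.
        by apply: negligibleU; apply/negligibleP => //; exact: lebesgue_measure_set1.
      apply: negligible_bigcup => k.
      have [Sk|nSk] := pselect ((@lebesgue_measure R).-negligible (S k)).
        by apply: negligibleS Sk => x [].
      by rewrite (_ : W k = set0) -?subset0 => [|x [kpq _]];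
        [exact: negligible_set0|apply: H; exists k].
    move=> x [[Ex _]] /=; rewrite in_itv /= => /andP[].
    rewrite le_eqVlt => /orP[/eqP->|px]; first by right; left.
    rewrite le_eqVlt => /orP[/eqP->|xq]; first by right; right.
    have [m /andP[pm mx]] := nth_rat_dense px.
    have [n /andP[xn nq]] := nth_rat_dense xq.
    left; exists (pickle (m, n)) => //; rewrite /W /S /lo /hi pickleK /=.
    split; last by split => //=; rewrite in_itv /= !ltW.
    move=> y /=; rewrite !in_itv /= => /andP[y1 y2].
    by rewrite (le_trans (ltW pm) y1) (le_trans y2 (ltW nq)).
  have [_ US U0 _] := UP k.
  apply: (lt_le_trans (U0 _)); first exact/lebesgue_gt0.
  apply: le_lebesgue => //.
    by apply: measurableI => //; exact: measurableI.
  move=> x Ux; have [Ex kx] := US x Ux; split; last exact: kpq.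
  by split => //; exists k.
Qed.

(** [t] is a density point and [s] a point of [B] within [2 * k * r] of [t - r]. The part of
    [[t - r, t]] outside [B] has measure at most [k * r], and this is at most [2 * k * (t - s)]
    because [k <= 1 / 4] gives [t - s >= r / 2]. *)
Lemma density_pair (R : realType) (B : set R) (k : R) :
  measurable B -> (0 < lebesgue_measure B)%E -> 0 < k -> k <= 1 / 4 ->
  exists s t, [/\ B s, B t, s < t &
    (((1 - 2 * k) * (t - s))%:E <= lebesgue_measure (B `&` `[s, t]%classic))%E].
Proof.
move=> mB /(lebesgue_gt0 mB) B0 k0 k4.
have [x [Bx xdens]] : exists x, B x /\
    (lebesgue_measure (B `&` ball x r) * (lebesgue_measure (ball x r))^-1)%E
      @[r --> 0^'+] --> (\1_B x)%:E.
  apply: contrapT => H; apply: B0; apply: negligibleS (lebesgue_density mB).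
  by move=> y By /= h; apply: H; exists y.
have [r [r0 rdens]] : exists r, 0 < r /\
    (((2 - k) * r)%:E < lebesgue_measure (B `&` ball x r))%E.
  move: xdens; rewrite indicE mem_set// => /fine_cvgP[fin /cvgr_gt/(_ (1 - k / 2))].
  have k1 : 1 - k / 2 < 1 by lra.
  move=> /(_ k1) gt.
  have r_gt0 : \forall r \near (0 : R)^'+, 0 < r by exact: nbhs_right_gt.
  have [r [[r0 finr] gtr]] := filter_ex (filterI (filterI r_gt0 fin) gt).
  exists r; split => //.
  have : ((1 - k / 2)%:E < lebesgue_measure (B `&` ball x r) *
      (lebesgue_measure (ball x r))^-1)%E by rewrite -(fineK finr) lte_fin.
  rewrite lebesgue_measure_ball ?ltW// inver gt_eqF ?mulrn_wgt0//.
  rewrite lte_pdivlMr ?mulrn_wgt0//.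
  by rewrite -EFinM; congr (_ < _)%E; congr (_%:E); rewrite -mulr_natr; field.
pose J : set R := B `&` `[x - r, x]%classic.
have mJ : measurable J by apply: measurableI => //; exact: measurable_itv.
pose I2 : set R := `[x, x + r]%classic.
have Jr : (((1 - k) * r)%:E < lebesgue_measure J)%E.
  have : (lebesgue_measure (B `&` ball x r) <=
      lebesgue_measure J + lebesgue_measure I2)%E.
    apply: (@le_trans _ _ (lebesgue_measure (J `|` I2))).
      apply: le_lebesgue.
      - by apply: measurableI => //; exact: measurable_ball.
      - by apply: measurableU => //; exact: measurable_itv.
      - move=> y [By]; rewrite /ball /= ltr_distlC => /andP[y1 y2].
        have [yx|/ltW xy] := leP y x; [left; split => //|right];
          by rewrite /I2 /= in_itv /= ?yx ?xy ?ltW.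
    by apply: measureU2 => //; exact: measurable_itv.
  rewrite lebesgue_measure_itv /= lte_fin ltrDl r0 -EFinD addrAC subrr add0r.
  move=> /(lt_le_trans rdens); rewrite -lteBlDr// -EFinB.
  by congr (_ < _)%E; congr (_%:E); ring.
have kr : 0 < k * r by rewrite mulr_gt0.
have kr4 : k * r <= r / 4 by rewrite mulrC ler_pM2l; lra.
have [s [Bs s1 s2]] : exists s, [/\ B s, x - r <= s & s < x - r + 2 * k * r].
  pose I3 : set R := `[x - r + 2 * k * r, x]%classic.
  apply: contrapT => H; move: Jr; apply/negP; rewrite -leNgt.
  apply: (@le_trans _ _ (lebesgue_measure I3)).
    apply: le_lebesgue => //; first exact: measurable_itv.
    move=> y [By]; rewrite /I3 /= !in_itv /= => /andP[y1 ->]; rewrite andbT leNgt.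
    by apply/negP => y2; apply: H; exists y.
  rewrite lebesgue_measure_itv /= lte_fin; case: ifP => _; last first.
    by rewrite lee_fin; lra.
  by rewrite -EFinD lee_fin; lra.
have sx : s < x by lra.
exists s, x; split => //.
pose I1 : set R := `[x - r, s]%classic.
have : (lebesgue_measure J <= lebesgue_measure (B `&` `[s, x]%classic) +
    lebesgue_measure I1)%E.
  apply: (@le_trans _ _ (lebesgue_measure
      ((B `&` `[s, x]%classic) `|` I1))).
    apply: le_lebesgue => //.
      by apply: measurableU; [apply: measurableI => //|]; exact: measurable_itv.
    move=> y [By]; rewrite /= !in_itv /= => /andP[y1 y2].
    by have [sy|/ltW ys] := leP s y; [left; split => //=|right];
      rewrite /I1 /= ?in_itv /= ?sy ?y1.
  by apply: measureU2; [apply: measurableI => //|]; exact: measurable_itv.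
rewrite lebesgue_measure_itv /= lte_fin.
have -> : (if (x - r < s)%R then (s%:E - (x - r)%:E)%E else 0%:E) = (s - (x - r))%:E.
  case: ltP => [_|h]; first by rewrite -EFinB.
  by congr (_%:E); apply/eqP; rewrite eq_sym subr_eq0 eq_le s1 h.
move=> /(lt_le_trans Jr); rewrite -lteBlDr// -EFinB => /ltW; apply: le_trans.
rewrite lee_fin; have : 0 <= k * (2 * (x - s) - r) by rewrite mulr_ge0; lra.
lra.
Qed.

(** * Subsets of the line *)

Definition subline (R : realType) (E : set R) : Type := set_type E.

Section subline.
Context (R : realType) (E : set R).

HB.instance Definition _ := Choice.on (subline E).

Definition line_val (x : subline E) : R := set_val x.

Lemma line_valP x : E (line_val x).
Proof. exact: set_valP. Qed.

Lemma line_valK s : E s -> exists x, line_val x = s.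
Proof. by move=> Es; exists (exist _ s (mem_set Es)). Qed.

Let dist (x y : subline E) : R := `|line_val x - line_val y|.

Let distxx x : dist x x = 0.
Proof. by rewrite /dist subrr normr0. Qed.

Let dist_positivity x y : dist x y = 0 -> x = y.
Proof. by move/normr0_eq0/eqP; rewrite subr_eq0 => /eqP/val_inj. Qed.

Let dist_sym x y : dist x y = dist y x.
Proof. exact: distrC. Qed.

Let dist_triangle y x z : dist x z <= dist x y + dist y z.
Proof. exact: ler_distD. Qed.

HB.instance Definition _ := @isMetric.Build R (subline E)
  dist distxx dist_positivity dist_sym dist_triangle.

Lemma subline_dist (x y : subline E) :
  mdist x y = `|line_val x - line_val y|.
Proof. by []. Qed.

End subline.

(** The distribution function of Lebesgue measure restricted to [A]. *)
Definition mass_below (R : realType) (A : set R) (t : R) : R :=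
  fine (lebesgue_measure (A `&` `]-oo, t]%classic)).

Section mass_below.
Context (R : realType) (A : set R).
Hypotheses (mA : measurable A) (Afin : (lebesgue_measure A < +oo)%E).

Lemma mass_belowB s t : s <= t ->
  lebesgue_measure (A `&` `[s, t]%classic) =
    (mass_below A t - mass_below A s)%:E.
Proof.
move=> st.
have mI (i : interval R) : measurable (A `&` [set` i] : set R).
  by apply: measurableI => //; exact: measurable_itv.
have fin (i : interval R) : lebesgue_measure (A `&` [set` i] : set R) \is a fin_num.
  rewrite ge0_fin_numE//; apply: le_lt_trans Afin.
  by apply: le_lebesgue => //; exact: subIsetl.
have splitA (i j k : interval R) :
    [set` i] = [set` j] `|` [set` k] -> [set` j] `&` [set` k] = set0 ->
    lebesgue_measure (A `&` [set` i] : set R) =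
      (lebesgue_measure (A `&` [set` j]) + lebesgue_measure (A `&` [set` k]))%E.
  move=> -> jk; rewrite setIUr measureU//; [exact: mI|exact: mI|].
  by rewrite setIACA setIid jk setI0.
have t1 := splitA `]-oo, t] `]-oo, s] `]s, t].
have t2 := splitA `[s, t] `[s, s] `]s, t].
have s0 : lebesgue_measure (A `&` `[s, s]%classic : set R) = 0%E.
  apply/eqP; rewrite -measure_le0 -(lebesgue_measure_set1 s).
  apply: le_lebesgue; [exact: (mI `[s, s])|exact: measurable_set1|].
  by rewrite set_itv1; exact: subIsetr.
rewrite EFinB /mass_below !fineK// t1.
- rewrite t2 ?s0 ?add0e.
  + by rewrite addeAC subee// add0e.
  + apply/seteqP; split=> x /=; rewrite !in_itv /=.
      by move=> /andP[sx ->]; rewrite sx; have [xs|_] := leP x s; [left|right].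
    by case=> [/andP[sx xs]|/andP[/ltW-> ->]//]; rewrite sx (le_trans xs).
  + rewrite -subset0 => x /=; rewrite !in_itv /= => -[/andP[_ xs] /andP[]].
    by rewrite ltNge xs.
- apply/seteqP; split=> x /=; rewrite !in_itv /=.
    by move=> ->; rewrite andbT; have [|] := leP x s; [left|right].
  by case=> [xs|/andP[]//]; exact: le_trans st.
- by rewrite -subset0 => x /=; rewrite !in_itv /= => -[xs /andP[]]; rewrite ltNge xs.
Qed.

Lemma mass_below_bounds s t : s <= t ->
  0 <= mass_below A t - mass_below A s <= t - s.
Proof.
move=> st; rewrite -!lee_fin -mass_belowB// measure_ge0 /=.
apply: (@le_trans _ _ (lebesgue_measure (`[s, t]%classic : set R))).
  apply: le_lebesgue; [|exact: measurable_itv|exact: subIsetr].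
  by apply: measurableI => //; exact: measurable_itv.
rewrite lebesgue_measure_itv /= lte_fin; case: ifP => _; first by rewrite -EFinB.
by rewrite lee_fin subr_ge0.
Qed.

End mass_below.

(** * Failure of density on subsets of the line *)

Section lipschitz_maps.
Context (R : realType) (N : metricType R) (Y : completeNormedModType R) (z : N).
Implicit Types f g : N -> Y.

Lemma min_modulus_le f x y : x <> y -> min_modulus f <= slope f x y.
Proof.
move=> xy; apply: ge_inf; last by exists x, y.
by exists 0 => _ [u [v [_ ->]]]; rewrite divr_ge0// mdist_ge0.
Qed.

Lemma lip_norm_ge f x y : Lip0 Y z f ->
  `|f x - f y| <= lip_norm f * mdist x y.
Proof.
move=> [_ [L fL]]; have [->|/eqP xy] := eqVneq x y.
  by rewrite subrr normr0 mdistxx mulr0.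
rewrite -ler_pdivrMr; last by rewrite mdist_gt0; exact/eqP.
apply: ub_le_sup; last by exists x, y.
exists L => _ [u [v [uv ->]]].
by rewrite /slope ler_pdivrMr// mdist_gt0; exact/eqP.
Qed.

Lemma Lip0B f g : Lip0 Y z f -> Lip0 Y z g -> Lip0 Y z (f - g).
Proof.
move=> [fz [L fL]] [gz [K gK]]; split; first by rewrite !fctE fz gz subrr.
exists (L + K) => x y; rewrite !fctE mulrDl opprD opprK addrACA.
apply: le_trans (lerD (fL x y) (gK x y)).
by rewrite (distrC (g x)) [- g x + _]addrC ler_normD.
Qed.

End lipschitz_maps.

(** [f] has slopes between 1 and 2, near 1 at density points of [A] and near 2 at those of [E] minus
    [A]. An error of 1/8 leaves [g] increasing, so its minimum modulus is a growth rate, and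
    increments add up. *)
Lemma subline_not_SMA_dense (R : realType) (E : set R) (z : subline E) :
  measurable E -> (0 < lebesgue_measure E)%E -> (lebesgue_measure E < +oo)%E ->
  ~ SMA_dense R^o z.
Proof.
move=> mE E0 Efin dense.
have [A [mA AE A0 Atw]] := intertwined_subset mE E0 Efin.
have Afin : (lebesgue_measure A < +oo)%E.
  by apply: le_lt_trans Efin; exact: le_lebesgue.
pose F := mass_below A.
pose f (x : subline E) : R^o :=
  (2 * line_val x - F (line_val x)) - (2 * line_val z - F (line_val z)).
have Fb s t : s <= t -> 0 <= F t - F s <= t - s by exact: mass_below_bounds.
have f_lip : Lip0 R^o z f.
  split; first by rewrite /f subrr.
  exists 2 => x y; rewrite subline_dist.
  suff fL (u v : subline E) : line_val u <= line_val v ->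
      `|f u - f v| <= 2 * `|line_val u - line_val v|.
    have [xy|/ltW yx] := leP (line_val x) (line_val y); first exact: fL.
    by rewrite distrC (distrC (line_val x)); exact: fL.
  move=> uv; rewrite distrC (distrC (line_val u)).
  rewrite [`|line_val _ - _|]ger0_norm ?subr_ge0//.
  have := Fb _ _ uv; rewrite /f ler_norml => /andP[? ?].
  by apply/andP; split; lra.
have [g [[g_lip [p0 [q0 [pq0 gmin0]]]] gnear]] := dense f f_lip (1 / 8) ltac:(lra).
set m := min_modulus g in gmin0.
have fg x y : `|(f x - g x) - (f y - g y)| <= 1 / 8 * `|line_val x - line_val y|.
  have := lip_norm_ge x y (Lip0B f_lip g_lip); rewrite subline_dist => /le_trans; apply.
  by apply: ler_wpM2r => //; exact: ltW.
have fgB x y : line_val x <= line_val y ->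
    `|(f y - f x) - (g y - g x)| <= 1 / 8 * (line_val y - line_val x).
  move=> xy; have := fg y x; rewrite [`|line_val _ - _|]ger0_norm ?subr_ge0//.
  by have -> : f y - f x - (g y - g x) = f y - g y - (f x - g x) by ring.
have fB x y : f y - f x =
    2 * (line_val y - line_val x) - (F (line_val y) - F (line_val x)).
  by rewrite /f; ring.
have gm x y : line_val x < line_val y ->
    0 <= g y - g x /\ m * (line_val y - line_val x) <= g y - g x.
  move=> xy; have := fgB _ _ (ltW xy); have := Fb _ _ (ltW xy).
  rewrite fB ler_norml => /andP[_ F1] /andP[_ g1].
  have g0 : 0 <= g y - g x by lra.
  split => //; have xy' : x <> y by move=> exy; rewrite exy ltxx in xy.
  have := min_modulus_le g xy'; rewrite -/m /slope subline_dist.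
  rewrite distrC ger0_norm// distrC gtr0_norm ?subr_gt0// ler_pdivlMr ?subr_gt0//.
(* g increases at rate at least m, with equality over [p, q], hence with equality
   over any interval contained in it. *)
have [p [q [pq gmin]]] : exists p q : subline E, line_val p < line_val q /\
    g q - g p = m * (line_val q - line_val p).
  have val_neq : line_val p0 != line_val q0.
    by apply/eqP => /val_inj.
  have gm0 : `|g p0 - g q0| = m * `|line_val p0 - line_val q0|.
    by rewrite -gmin0 /slope subline_dist mulfVK// normr_eq0 subr_eq0.
  move: val_neq; rewrite neq_lt => /orP[pq|qp].
    exists p0, q0; split => //; have [g0 _] := gm _ _ pq.
    by move: gm0; rewrite distrC ger0_norm// distrC gtr0_norm ?subr_gt0.
  exists q0, p0; split => //; have [g0 _] := gm _ _ qp.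
  by move: gm0; rewrite ger0_norm// gtr0_norm ?subr_gt0.
(* Between two points where [A] has density at least 3/4, [f] has slope at most 5/4, and [g] at most
   1/8 more. *)
have m_le : m <= 1 + 2 * (1 / 8) + 1 / 8.
  have [|s [t [As At st Ast]]] := density_pair (k := 1 / 8) mA A0 _ ltac:(lra).
    by lra.
  have [x xs] := line_valK (AE _ As); have [y yt] := line_valK (AE _ At).
  have xy : line_val x < line_val y by rewrite xs yt.
  have [_] := gm _ _ xy; have := fgB _ _ (ltW xy).
  move: Ast; rewrite (mass_belowB mA Afin (ltW st)) lee_fin -/F => Ast.
  rewrite fB xs yt ler_norml => /andP[g1 _] g2.
  by rewrite -(ler_pM2r (_ : 0 < t - s)) ?subr_gt0//; lra.
(* Inside [[p, q]] the rate of [g] is [m], at most 11/8, so that of [f] is at most 12/8; as [f] is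
   [2 t - F t] up to a constant, [F] has rate at least 1/2. *)
have F_ge (x y : subline E) : line_val p <= line_val x -> line_val x < line_val y ->
    line_val y <= line_val q ->
    (1 - 4 * (1 / 8)) * (line_val y - line_val x) <= F (line_val y) - F (line_val x).
  move=> px xy yq.
  have gpx : m * (line_val x - line_val p) <= g x - g p.
    move: px; rewrite le_eqVlt => /orP[/eqP/val_inj->|/gm[]//].
    by rewrite !subrr mulr0.
  have gyq : m * (line_val q - line_val y) <= g q - g y.
    move: yq; rewrite le_eqVlt => /orP[/eqP/val_inj->|/gm[]//].
    by rewrite !subrr mulr0.
  have mxy : m * (line_val y - line_val x) <=
      (1 + 2 * (1 / 8) + 1 / 8) * (line_val y - line_val x).
    by rewrite ler_pM2r// subr_gt0.
  have := fgB _ _ (ltW xy); rewrite fB ler_norml => /andP[_].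
  by lra.
have mB : measurable ((E `\` A) `&` `[line_val p, line_val q]%classic).
  by apply: measurableI; [exact: measurableD|exact: measurable_itv].
have B0 : (0 < lebesgue_measure ((E `\` A) `&` `[line_val p, line_val q]%classic))%E.
  apply: Atw; rewrite (mass_belowB mA Afin (ltW pq)) lte_fin -/F.
  have := F_ge p q (lexx _) pq (lexx _); apply: lt_le_trans.
  by rewrite mulr_gt0 ?subr_gt0//; lra.
(* [E] minus [A] fills at least 7/9 of [[s, t]], so [F] has rate at most 2/9 there, below 1/2. *)
have [|s [t [Bs Bt st Bst]]] := density_pair (k := 1 / 9) mB B0 _ ltac:(lra).
  by lra.
have [[Es _]] := Bs; rewrite /= in_itv /= => /andP[ps sq].
have [[Et _]] := Bt; rewrite /= in_itv /= => /andP[pt tq].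
have [x xs] := line_valK Es; have [y yt] := line_valK Et.
have := F_ge x y; rewrite xs yt => /(_ ps st tq).
have mst : measurable (`[s, t]%classic : set R) by exact: measurable_itv.
have : (lebesgue_measure (A `&` `[s, t]%classic) +
    lebesgue_measure (((E `\` A) `&` `[line_val p, line_val q]%classic)
      `&` `[s, t]%classic) <= lebesgue_measure (`[s, t]%classic : set R))%E.
  rewrite -measureU//; [|exact: measurableI|exact: measurableI|].
    apply: le_lebesgue => //; last by move=> r [] [].
    by apply: measurableU; exact: measurableI.
  by rewrite -subset0 => r [[Ar _] [[[_ nAr] _] _]].
rewrite lebesgue_measure_itv /= lte_fin st -EFinB.
move=> /(le_trans (leeD (lexx _) Bst)).
rewrite (mass_belowB mA Afin (ltW st)) -EFinD lee_fin -/F.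
by lra.
Qed.

Section bilipschitz_curve.
Context (R : realType) (M : metricType R) (E : set R) (gamma : R -> M) (c L : R).
Hypotheses (L_gt0 : 0 < L)
  (gammaL : forall s t, E s -> E t -> mdist (gamma s) (gamma t) <= L * `|s - t|).

Lemma compact_lipschitz_image : compact E -> compact (gamma @` E).
Proof.
apply: continuous_compact; apply/subspace_continuousP => s Es U.
move=> /nbhs_ballP[e e0 eU]; apply/nbhs_ballP; exists (e / L) => /=.
  by rewrite divr_gt0.
move=> t; rewrite /ball /= ltr_pdivlMr// mulrC => st Et; apply: eU.
by rewrite ballEmdist /=; apply: le_lt_trans (gammaL Es Et) st.
Qed.

Hypotheses (c_gt0 : 0 < c)
  (gammac : forall s t, E s -> E t -> c * `|s - t| <= mdist (gamma s) (gamma t)).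

Lemma bilipschitz_copy_subline (z : subline E) :
  bilipschitz_copy (subline E) (gamma @` E).
Proof.
have inv y : exists x : subline E, (gamma @` E) y -> gamma (line_val x) = y.
  have [[s Es <-]|nEy] := pselect ((gamma @` E) y); last by exists z.
  by have [x xs] := line_valK Es; exists x => _; rewrite xs.
have [phi phiP] := choice inv.
have phi_gamma x : phi (gamma (line_val x)) = x.
  have : gamma (line_val (phi (gamma (line_val x)))) = gamma (line_val x).
    by apply: phiP; exists (line_val x) => //; exact: line_valP.
  set y := phi _ => yx; apply: mdist_positivity; apply/eqP.
  rewrite eq_le mdist_ge0 andbT -(ler_pM2l c_gt0) mulr0 subline_dist.
  by have := gammac (line_valP y) (line_valP x); rewrite yx mdistxx.
(* The summand [L^-1] makes the upper constant strictly larger than the lower one. *)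
exists phi, L^-1, (c^-1 + L^-1); split.
- split => //.
  + move=> y y' /set_mem Ky /set_mem Ky' yy'.
    by rewrite -(phiP _ Ky) -(phiP _ Ky') yy'.
  + move=> x _; exists (gamma (line_val x)) => //.
    by exists (line_val x) => //; exact: line_valP.
- by rewrite invr_gt0.
- by rewrite ltrDr invr_gt0.
- move=> _ _ [s Es <-] [t Et <-].
  have [x <-] := line_valK Es; have [y <-] := line_valK Et.
  rewrite !phi_gamma subline_dist; apply/andP; split.
    by rewrite mulrC ler_pdivrMr// mulrC; apply: gammaL; exact: line_valP.
  rewrite mulrDl; apply: ler_wpDr; first by rewrite mulr_ge0 ?mdist_ge0// invr_ge0 ltW.
  by rewrite mulrC ler_pdivlMr// mulrC; apply: gammac; exact: line_valP.
Qed.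

End bilipschitz_curve.

(** * Proof of the equivalence *)

Lemma hausdorff1_null_subset (R : realType) (M : metricType R) (E E' : set M) :
  E `<=` E' -> hausdorff1 E' = 0%E -> hausdorff1 E = 0%E.
Proof.
move=> EE' E'0; apply/eqP; rewrite eq_le hausdorff1_ge0 andbT -E'0.
apply: ge_ereal_sup => _ [d d0 <-].
apply: (@le_trans _ _ (hausdorff1_delta d E')); last first.
  by apply: ereal_sup_ubound; exists d.
apply: le_ereal_inf_tmp => _ [U [Ud E'U] <-]; apply: ereal_inf_lbound.
by exists U => //; split => //; exact: subset_trans E'U.
Qed.

Lemma purely_1_unrectifiable_of_SMA_dense (R : realType) (M : metricType R) :
  complete_metric M ->
  (forall (K : set M) (N : metricType R) (z : N),
     closed K -> bilipschitz_copy N K -> has_two_points N -> SMA_dense R^o z) ->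
  purely_1_unrectifiable M.
Proof.
move=> cM dense A0 gamma0 [L0 gL0].
pose L := `|L0| + 1; have L_gt0 : 0 < L by rewrite ltr_pwDr.
have gL0' s t : A0 s -> A0 t -> mdist (gamma0 s) (gamma0 t) <= L * `|s - t|.
  move=> As At; apply: le_trans (gL0 _ _ As At) _; apply: ler_wpM2r => //.
  by apply: le_trans (ler_norm _) _; rewrite lerDl.
have [gamma [gE gL]] := lipschitz_closure_extension cM L_gt0 gL0'.
apply: (@hausdorff1_null_subset _ _ _ (gamma @` closure A0)).
  by move=> _ [t At <-]; exists t; [exact: subset_closure|exact: gE].
(* The constant [2 * L] is the one of [bilipschitz_piece], which applies to any pair violating the
   gap estimate. *)
apply: (@hausdorff1_null_of_gaps _ _ _ _ (2 * L)); first exact: closed_closure.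
  by rewrite mulr_gt0.
move=> a b Aa Ab ab; rewrite leNgt; apply/negP => gap.
have [E [c [cE EA c0 E0 gc]]] :=
  bilipschitz_piece (@closed_closure _ A0) L_gt0 gL Aa Ab ab gap.
have gLE s t : E s -> E t -> mdist (gamma s) (gamma t) <= L * `|s - t|.
  by move=> /EA ? /EA ?; exact: gL.
have mE := compact_measurable cE.
(* Only two distinct points of [E] are wanted here: one as base point, both for [has_two_points]. *)
have [s [t [Es Et st _]]] := density_pair mE E0
  (ltac:(lra) : 0 < 1 / 8 :> R) (ltac:(lra) : 1 / 8 <= 1 / 4 :> R).
have [x xs] := line_valK Es; have [y yt] := line_valK Et.
apply: (@subline_not_SMA_dense _ _ x mE E0 (compact_finite_measure cE)).
apply: (dense (gamma @` E)).
- apply: compact_closed; first exact: metric_hausdorff.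
  exact: compact_lipschitz_image L_gt0 gLE cE.
- exact: bilipschitz_copy_subline L_gt0 gLE c0 gc x.
- by exists x, y => xy; move: st; rewrite -xs -yt xy ltxx.
Qed.

Theorem theorem2 (R : realType) (M : metricType R) (hM : complete_metric M) :
  [<-> (* (a) *) purely_1_unrectifiable M;
       (* (b) *) forall (K : set M) (N : metricType R) (z : N),
         closed K -> bilipschitz_copy N K -> has_two_points N ->
         SMA_dense R^o z;
       (* (c) *) forall (K : set M) (N : metricType R) (z : N)
           (Y : completeNormedModType R),
         closed K -> bilipschitz_copy N K -> has_two_points N ->
         SMA_dense Y z ].
Proof.
have ac : purely_1_unrectifiable M -> forall (K : set M) (N : metricType R)
    (z : N) (Y : completeNormedModType R),
    closed K -> bilipschitz_copy N K -> has_two_points N -> SMA_dense Y z.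
  move=> pM K N z Y cK MN; apply: SMA_dense_of_null_fragments.
    exact: bilipschitz_copy_complete MN hM cK.
  exact: bilipschitz_copy_null_fragments MN pM.
tfae.
- by move=> pM K N z; exact: ac.
(* (b) gives (c) by way of (a). *)
- by move=> b; apply: ac; exact: purely_1_unrectifiable_of_SMA_dense b.
- by move=> c; apply: purely_1_unrectifiable_of_SMA_dense => // K N z; exact: c.
Qed.
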